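(* An $m$-th root metric space $(M,F)$ is projectively flat if and only if around every point of $M$ there is a local coordinate system in which $$m\sum a_{i_1i_2\dots i_m}\,\gamma_{j\,j_1\dots j_m}=\sum a_{ji_2\dots i_m}\,a_{j_1\dots j_m,\,i_1}$$ for all $j,i_1,\dots,i_m,j_1,\dots,j_m\in\{1,\dots,n\}$, where $\sum$ denotes symmetrization with respect to the $2m$ indices $i_1,\dots,i_m,j_1,\dots,j_m$.
   Context: Let $M$ be a smooth $n$-dimensional manifold with induced coordinates $(x^i,y^i)$ on $TM$. An $m$-th root metric space ($m\ge 2$) is $(M,F)$ with $F=\sqrt[m]{a_{i_1\dots i_m}(x)y^{i_1}\cdots y^{i_m}}$, where $a_{i_1\dots i_m}$ is totally symmetric and $g_{ij}=\frac12\frac{\partial^2F^2}{\partial y^i\partial y^j}$ is nondegenerate on $TM\setminus\{0\}$ (at the points where $F$ is defined and smooth); $g$ may have arbitrary signature. Here $a_{j_1\dots j_m,\,r}=\partial a_{j_1\dots j_m}/\partial x^r$ and $\gamma_{j\,j_1\dots j_m}=\frac1{m(m-1)}\Big(\sum_{(j_1,\dots,j_m)}\frac{\partial a_{jj_2\dots j_m}}{\partial x^{j_1}}-\frac{\partial a_{j_1\dots j_m}}{\partial x^j}\Big)$, where $\sum_{(j_1,\dots,j_m)}$ is the cyclic sum; symmetrization means summing over all permutations of the listed indices. $(M,F)$ is projectively flat if its geodesics are straight lines, i.e. around every point there is a coordinate system in which the geodesics are, as point sets, straight lines (equivalently, $(M,F)$ is projective to a locally Minkowski space). *)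

(* Defs.v *)
From HB Require Import structures.
From mathcomp Require Import all_boot all_order all_algebra all_fingroup.
From mathcomp Require Import all_classical all_reals all_analysis.

Set Implicit Arguments.
Unset Strict Implicit.
Unset Printing Implicit Defensive.

Import Order.TTheory GRing.Theory Num.Theory.
Import numFieldNormedType.Exports.

Local Open Scope classical_set_scope.
Local Open Scope ring_scope.

(* C^k on an open set U, for maps between finite-dimensional normed spaces:
   all iterated directional derivatives up to order k exist and are continuous
   on U.  The values of f outside U are irrelevant. *)
Fixpoint Ck_on (R : realType) (V W : normedModType R) (k : nat)
    (U : set V) (f : V -> W) : Prop :=
  (forall x, U x -> {for x, continuous f}) /\
  match k with
  | 0 => True
  | k'.+1 => forall v : V,
      (forall x, U x -> derivable f x v) /\ Ck_on k' U ('D_v f)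
  end.

Definition smooth_on (R : realType) (V W : normedModType R)
    (U : set V) (f : V -> W) : Prop := forall k, Ck_on k U f.

Record chart (R : realType) (M : topologicalType) (n : nat) := Chart {
  chart_dom : set M ;
  chart_map : M -> 'rV[R]_n ;
  chart_inv : 'rV[R]_n -> M ;
  chart_dom_open : open chart_dom ;
  chart_im_open : open (chart_map @` chart_dom) ;
  chart_mapK : {in chart_dom, cancel chart_map chart_inv} ;
  chart_map_cont : forall p, chart_dom p -> {for p, continuous chart_map} ;
  chart_inv_cont : forall x, (chart_map @` chart_dom) x ->
    {for x, continuous chart_inv}
}.

Definition chart_im (R : realType) (M : topologicalType) (n : nat)
    (c : chart R M n) : set 'rV[R]_n := chart_map c @` chart_dom c.

(* The coordinate change from the coordinates of c to those of d, meaningful on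
   chart_map c @` (chart_dom c `&` chart_dom d). *)
Definition transition (R : realType) (M : topologicalType) (n : nat)
    (c d : chart R M n) : 'rV[R]_n -> 'rV[R]_n := chart_map d \o chart_inv c.

Definition compatible (R : realType) (M : topologicalType) (n : nat)
    (c d : chart R M n) : Prop :=
  smooth_on (chart_map c @` (chart_dom c `&` chart_dom d)) (transition c d) /\
  smooth_on (chart_map d @` (chart_dom c `&` chart_dom d)) (transition d c).

(* A smooth manifold structure: the atlas is maximal, so that a local coordinate
   system of the manifold is exactly an element of the atlas. *)
Record smooth_manifold (R : realType) (M : topologicalType) (n : nat) :=
  SmoothManifold {
  atlas : set (chart R M n) ;
  mfd_hausdorff : hausdorff_space M ;
  mfd_second_countable : @second_countable M ;
  atlas_cover : forall p : M, exists2 c, atlas c & chart_dom c p ;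
  atlas_compat : forall c d, atlas c -> atlas d -> compatible c d ;
  atlas_max : forall c, (forall d, atlas d -> compatible c d) -> atlas c
}.

Definition basis_vec (R : realType) (n : nat) (i : 'I_n) : 'rV[R]_n :=
  delta_mx 0 i.

Section Coordinates.
Context {R : realType} {n : nat}.

Definition partial (i : 'I_n) (f : 'rV[R]_n -> R) : 'rV[R]_n -> R :=
  'D_(basis_vec R i) f.

(* Points of the induced coordinates on TM are pairs (x, y); these are
   d/dx^i and d/dy^i. *)
Definition partial_x (i : 'I_n) (L : 'rV[R]_n * 'rV[R]_n -> R) :
    'rV[R]_n * 'rV[R]_n -> R := 'D_(basis_vec R i, 0) L.

Definition partial_y (i : 'I_n) (L : 'rV[R]_n * 'rV[R]_n -> R) :
    'rV[R]_n * 'rV[R]_n -> R := 'D_(0, basis_vec R i) L.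

(* Components a_{i_1 ... i_m}(x), in one coordinate system; the index position
   r is numbered from 0. *)
Definition components (m : nat) := {ffun 'I_m -> 'I_n} -> 'rV[R]_n -> R.

Definition mform (m : nat) (a : components m) (z : 'rV[R]_n * 'rV[R]_n) : R :=
  \sum_(I : {ffun 'I_m -> 'I_n}) a I z.1 * \prod_(r < m) z.2 0 (I r).

(* The real m-th root, of an arbitrary real number if m is odd and of a
   nonnegative one if m is even. *)
Definition has_mroot (m : nat) (s : R) : bool := odd m || (0 <= s).
Definition mroot (m : nat) (s : R) : R := Num.sg s * `|s| `^ (m%:R^-1).

Definition mroot_F (m : nat) (a : components m) (z : 'rV[R]_n * 'rV[R]_n) : R :=
  mroot m (mform a z).

(* The points (x, y) of TM minus the zero section, x in D, at which F is
   defined and smooth. *)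
Definition regular (D : set 'rV[R]_n) (m : nat) (a : components m)
    (z : 'rV[R]_n * 'rV[R]_n) : Prop :=
  z.2 != 0 /\
  exists U : set ('rV[R]_n * 'rV[R]_n),
    [/\ open U, U z,
        (forall w, U w -> D w.1 /\ has_mroot m (mform a w)) &
        smooth_on U (mroot_F a)].

Definition metric_tensor (m : nat) (a : components m)
    (z : 'rV[R]_n * 'rV[R]_n) : 'M[R]_n :=
  \matrix_(i, j)
    (2^-1 * partial_y i (partial_y j (fun w => mroot_F a w ^+ 2)) z).

(* G^i = 1/4 g^{ij} (d^2 F^2 / dx^k dy^j  y^k - d F^2 / dx^j). *)
Definition spray (m : nat) (a : components m)
    (z : 'rV[R]_n * 'rV[R]_n) (i : 'I_n) : R :=
  4^-1 * \sum_(j < n) invmx (metric_tensor a z) i j *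
    (\sum_(k < n)
        partial_x k (partial_y j (fun w => mroot_F a w ^+ 2)) z * z.2 0 k
     - partial_x j (fun w => mroot_F a w ^+ 2) z).

(* Geodesics inside D, in coordinates: x'' + 2 G(x, x') = 0 on an open interval
   T.  The equation is invariant under changes of coordinates. *)
Definition geodesic (D : set 'rV[R]_n) (m : nat) (a : components m)
    (T : set R) (x : R -> 'rV[R]_n) : Prop :=
  [/\ open T, is_interval T &
      forall t, T t ->
        [/\ D (x t), derivable x t 1, derivable (derive1 x) t 1,
            regular D a (x t, derive1 x t) &
            forall i, derive1 (derive1 x) t 0 i + 2 * spray a (x t, derive1 x t) i = 0]].

(* A geodesic need not be maximal, nor the coordinate domain convex: as a point
   set it is a piece of a straight line. *)
Definition straight (A : set 'rV[R]_n) : Prop :=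
  exists (p v : 'rV[R]_n) (J : set R),
    [/\ v != 0, is_interval J & A = [set p + s *: v | s in J]].

(* The multi-index (j, i_2, ..., i_m), for I = (i_1, ..., i_m). *)
Definition set_first (m : nat) (j : 'I_n) (I : {ffun 'I_m -> 'I_n}) :
    {ffun 'I_m -> 'I_n} := [ffun r : 'I_m => if r == 0%N :> nat then j else I r].

(* The multi-index (i_{1+s}, ..., i_m, i_1, ..., i_s). *)
Definition cyc (m : nat) (s : nat) (I : {ffun 'I_m -> 'I_n}) :
    {ffun 'I_m -> 'I_n} := [ffun r => I (iter s (@ordS m) r)].

Definition gamma (m : nat) (a : components m) (j : 'I_n)
    (J : {ffun 'I_m -> 'I_n}) (x : 'rV[R]_n) : R :=
  (m%:R * (m%:R - 1))^-1 *
  (\sum_(s < m) partial (J s) (a (set_first j (cyc s J))) x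
   - partial j (a J) x).

(* Sum of T over all permutations of the 2m indices (i_1,...,i_m,j_1,...,j_m). *)
Definition symm (m : nat)
    (T : {ffun 'I_m -> 'I_n} -> {ffun 'I_m -> 'I_n} -> R)
    (I J : {ffun 'I_m -> 'I_n}) : R :=
  let IJ (r : 'I_(m + m)) :=
    match fintype.split r with inl i => I i | inr i => J i end in
  \sum_(s : 'S_(m + m))
    T [ffun r => IJ (s (lshift m r))] [ffun r => IJ (s (rshift m r))].

End Coordinates.

Definition first_pos (m : nat) (hm : (2 <= m)%N) : 'I_m := Ordinal (ltnW hm).

(* A smooth totally symmetric covariant tensor field a of rank m, given by its
   components in all the coordinate systems, such that F is a (possibly conic)
   Finsler metric: over each point F is defined and smooth in some direction. *)
Record mroot_metric (R : realType) (M : topologicalType) (n m : nat)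
    (S : smooth_manifold R M n) := MrootMetric {
  comps : chart R M n -> {ffun 'I_m -> 'I_n} -> 'rV[R]_n -> R ;
  comps_smooth : forall c I, atlas S c ->
    smooth_on (chart_im c) (comps c I) ;
  comps_sym : forall c (I : {ffun 'I_m -> 'I_n}) (s : 'S_m) x, atlas S c -> chart_im c x ->
    comps c [ffun r => I (s r)] x = comps c I x ;
  comps_tensor : forall c d (I : {ffun 'I_m -> 'I_n}) p, atlas S c -> atlas S d ->
    chart_dom c p -> chart_dom d p ->
    comps c I (chart_map c p) =
    \sum_(K : {ffun 'I_m -> 'I_n}) comps d K (chart_map d p) *
      \prod_(r < m)
        ('D_(basis_vec R (I r)) (transition c d) (chart_map c p)) 0 (K r) ;
  metric_defined : forall c x, atlas S c -> chart_im c x ->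
    exists y, regular (chart_im c) (comps c) (x, y) ;
  metric_nondeg : forall c z, atlas S c ->
    regular (chart_im c) (comps c) z -> \det (metric_tensor (comps c) z) != 0
}.

Definition projectively_flat (R : realType) (M : topologicalType) (n m : nat)
    (S : smooth_manifold R M n) (a : mroot_metric m S) : Prop :=
  forall p : M, exists c : chart R M n,
    [/\ atlas S c, chart_dom c p &
        forall T x, geodesic (chart_im c) (comps a c) T x -> straight (x @` T)].

(* Main.v *)
(* Write [A = F^m = a_I(x) y^I].  Geodesics are straight lines, as point sets,
   exactly when the acceleration is parallel to the velocity, i.e. [G^i = P y^i],
   and Euler's identities turn this into Hamel's equations
   [y^k F_{x^k y^j} = F_{x^j}], the factor being forced to be [P = y^k F_{x^k} / 2F].
   (A regular point has [F <> 0], for otherwise [g_{ij} y^j = F F_{y^i} = 0].)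
   In terms of [A] they read
   [m A (y^k A_{x^k y^j} - A_{x^j}) = (m - 1) A_{y^j} y^k A_{x^k}], which is
   polynomial in [y]; its full polarization is the stated system.
   From straight geodesics to Hamel's equations one needs a geodesic through
   every regular point, i.e. Picard's theorem for the spray; the equations then
   hold for [y] in a nonempty open set, which suffices for the polarization. *)
Require Import Defs.
From mathcomp Require Import all_boot all_order all_algebra all_fingroup.
From mathcomp Require Import all_classical all_reals all_analysis.
From mathcomp Require Import ring lra.

Set Implicit Arguments.
Unset Strict Implicit.
Unset Printing Implicit Defensive.

Import Order.TTheory GRing.Theory Num.Theory.
Import numFieldNormedType.Exports.
Local Open Scope classical_set_scope.
Local Open Scope ring_scope.

(** * Functions with continuous directional derivatives *)

(** [smooth_on] provides derivatives one direction at a time. Euler's identities and the Lipschitz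
    bounds for the spray need the derivative to be linear in its direction, and this is derived from
    the mean value theorem along segments and the continuity of the derivatives. F and A live on
    different sets: F is smooth only near regular points, while A is polynomial in y over the whole
    chart. Every argument about the metric stays in a neighbourhood where F^m = A. Only the
    polynomial identity leaves it: vanishing on a small ball of directions becomes a condition on
    the coefficients, and from there an identity for all directions. The spray, too, is known to be
    Lipschitz only near a regular point. For the iteration the field is therefore precomposed with a
    retraction onto a cube, and time is clamped to a short interval; for small times both
    retractions act as the identity along the solution. *)

Lemma scale_one (R : realType) (h : R) : h *: (1 : R) = h.
Proof. exact: mulr1. Qed.

Lemma is_derive_line (R : realType) (V W : normedModType R) (f : V -> W) (z w : V) (t : R) :
  derivable f (z + t *: w) w ->
  is_derive t 1 (fun s : R => f (z + s *: w)) ('D_w f (z + t *: w)).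
Proof.
have E : (fun h : R => h^-1 *: (((fun s : R => f (z + s *: w)) \o shift t) (h *: (1 : R)) -
    f (z + t *: w))) = (fun h : R => h^-1 *: ((f \o shift (z + t *: w)) (h *: w) - f (z + t *: w))).
  apply/funext => h /=; congr (_ *: (f _ - _)).
  by rewrite scale_one scalerDl addrCA.
by move=> df; apply: DeriveDef; rewrite /derivable /derive /= E.
Qed.

Lemma MVT_line (R : realType) (V : normedModType R) (f : V -> R) (z w : V) :
  (forall t : R, 0 <= t <= 1 -> derivable f (z + t *: w) w) ->
  exists2 t : R, 0 <= t <= 1 & f (z + w) - f z = 'D_w f (z + t *: w).
Proof.
move=> df.
have d (t : R) : t \in `[0, 1] -> is_derive t 1 (fun s : R => f (z + s *: w)) ('D_w f (z + t *: w)).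
  by rewrite in_itv /= => /df /is_derive_line.
have d1 (t : R) : t \in `]0, 1[ -> is_derive t 1 (fun s : R => f (z + s *: w)) ('D_w f (z + t *: w)).
  by move=> t01; apply: d; exact: subset_itv_oo_cc.
have cf : {within `[0, 1], continuous (fun s : R => f (z + s *: w))}.
  by apply: derivable_within_continuous => t /d [].
have [t] := MVT_segment ler01 d1 cf.
rewrite in_itv /= scale1r scale0r addr0 subr0 mulr1 => t01 E.
by exists t.
Qed.

(** The chain rule along the line z + s v with inner function s -> k s; this covers k = 0 as
    well. *)
Lemma derive_scale_dir (R : realType) (V : normedModType R) (f : V -> R) (z v : V) (k : R) :
  derivable f z v -> is_derive z (k *: v) f (k * 'D_v f z).
Proof.
move=> df.
have d0 : is_derive (k * 0 : R) 1 (fun s : R => f (z + s *: v)) ('D_v f z).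
  have -> : 'D_v f z = 'D_v f (z + (k * 0) *: v) by rewrite mulr0 scale0r addr0.
  by apply: is_derive_line; rewrite mulr0 scale0r addr0.
have dk : is_derive (0 : R) 1 (fun s : R => k * s) k.
  have -> : (fun s : R => k * s) = k \*: id by [].
  by apply: is_derive_eq; exact: mulr1.
have := @is_derive1_comp _ _ _ _ _ _ d0 dk.
set g := (X in is_derive _ _ X) => -[dg eg].
have E : (fun h : R => h^-1 *: ((f \o shift z) (h *: (k *: v)) - f z)) =
   (fun h : R => h^-1 *: ((g \o shift 0) (h *: (1 : R)) - g 0)).
  apply/funext => h /=; rewrite /g /= mulr0 scale0r !addr0.
  have -> : h *: (k *: v) + z = z + (k * (h *: (1 : R))) *: v.
    by rewrite scale_one addrC scalerA mulrC.
  by [].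
by split; rewrite /derivable /derive ?E // mulrC -eg.
Qed.

Lemma C1_derivable (R : realType) (V : normedModType R) k (U : set V) (f : V -> R) (x u : V) :
  Ck_on k.+1 U f -> U x -> derivable f x u.
Proof. by move=> [_ /(_ u) [+ _]] => + Ux; apply. Qed.

Lemma C1_cont_derive (R : realType) (V : normedModType R) k (U : set V) (f : V -> R) (x u : V) :
  Ck_on k.+1 U f -> U x -> {for x, continuous ('D_u f)}.
Proof. by move=> [_ /(_ u) [_]]; case: k => [[+ _]|k [+ _]] => + Ux; apply. Qed.

(** The increment along h (v + w) is a step h v from z followed by a step h w. By the mean value
    theorem the second step contributes h times ['D_w f] at a point that tends to z with h, and
    continuity of ['D_w f] at z concludes. *)
Lemma C1_derive_add (R : realType) (V : normedModType R) (U : set V) (f : V -> R) (z v w : V) :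
  open U -> U z -> Ck_on 1 U f -> 'D_(v + w) f z = 'D_v f z + 'D_w f z.
Proof.
move=> oU Uz C1.
apply/cvg_lim => //.
apply/cvgrPdist_le => e e0.
have e20 : 0 < e / 2 by rewrite divr_gt0.
have cw := C1_cont_derive (u := w) C1 Uz.
have [r /= r0 Br] : exists2 r : R, 0 < r & forall x, `|z - x| < r ->
   U x /\ `|'D_w f z - 'D_w f x| <= e / 2.
  have /nbhs_normP [r r0 H] : nbhs z (U `&` [set x | `|'D_w f z - 'D_w f x| <= e / 2]).
    apply: filterI; first by move: oU; rewrite openE; apply.
    by have /cvgrPdist_le /(_ _ e20) := cw.
  by exists r => // x xr; apply: (H x); rewrite /ball_ /=.
have /cvgrPdist_le /(_ _ e20) := C1_derivable (u := v) C1 Uz.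
rewrite -/(derive f z v) => dv.
(* For |h| N < r every point z + h v + t h w with t in [0, 1] lies in the ball of radius r; the
   summand 1 makes N positive. *)
pose N := `|v| + `|w| + 1.
have N0 : 0 < N by rewrite ltr_wpDl // addr_ge0.
near=> h.
have hN : `|h| < r / N by near: h; apply: dnbhs0_lt; rewrite divr_gt0.
have h0 : h != 0 by near: h; exact: nbhs_dnbhs_neq.
have nb (t : R) : 0 <= t <= 1 -> `|z - (z + h *: v + t *: (h *: w))| < r.
  move=> /andP [t0 t1]; rewrite opprD addrA opprD addrA subrr sub0r -opprD normrN.
  rewrite (le_lt_trans (ler_normD _ _)) // !normrZ (ger0_norm t0).
  apply: (@le_lt_trans _ _ (`|h| * N)); last by rewrite -ltr_pdivlMr.
  rewrite mulrCA -mulrDr ler_wpM2l // /N -addrA lerD2l.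
  by rewrite (@le_trans _ _ `|w|) ?lerDl // ler_piMl.
have [t t01 E] : exists2 t : R, 0 <= t <= 1 &
    f (z + h *: v + h *: w) - f (z + h *: v) = 'D_(h *: w) f (z + h *: v + t *: (h *: w)).
  by apply: MVT_line => t /nb /Br [/(C1_derivable (u := h *: w) C1)].
have [Ut Dt] := Br _ (nb _ t01).
have -> : h^-1 *: ((f \o shift z) (h *: (v + w)) - f z) =
   h^-1 *: ((f \o shift z) (h *: v) - f z) + 'D_w f (z + h *: v + t *: (h *: w)).
  rewrite (derive_val (is_derive := derive_scale_dir h (C1_derivable (u := w) C1 Ut))) in E.
  rewrite -[X in _ = _ + X](mulKf h0) -E -scalerDr; congr (_ *: _) => /=.
  rewrite scalerDr [h *: v + z]addrC [h *: v + _ + z]addrC addrA.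
  by rewrite [RHS]addrC addrA subrK.
rewrite opprD addrACA (le_trans (ler_normD _ _)) // (splitr e) lerD //.
by near: h.
Unshelve. all: by end_near. Qed.

Lemma C1_derive_sum (R : realType) (V : normedModType R) (U : set V) (f : V -> R) (z : V)
    (T : Type) (s : seq T) (c : T -> R) (e : T -> V) :
  open U -> U z -> Ck_on 1 U f ->
  'D_(\sum_(i <- s) c i *: e i) f z = \sum_(i <- s) c i * 'D_(e i) f z.
Proof.
move=> oU Uz C1; elim: s => [|i s IH]; first by rewrite !big_nil derive0.
rewrite !big_cons (C1_derive_add _ _ oU Uz C1) IH; congr (_ + _).
exact: (derive_val (is_derive := derive_scale_dir (c i) (C1_derivable C1 Uz))).
Qed.

Definition lip_near (R : realType) (V : normedModType R) (z : V) (h : V -> R) :=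
  exists L r : R, [/\ 0 <= L, 0 < r &
    forall u v, `|u - z| < r -> `|v - z| < r -> `|h u - h v| <= L * `|u - v|].

(** On a small ball each derivative along [e i] is bounded by its value at z plus 1. The segment
    from v to u stays in the ball by convexity, and the mean value theorem gives the derivative
    along u - v, which is expanded in the frame [e]. The coordinates [c] are abstract because phase
    space is a product of two row spaces. *)
Lemma C1_lip_near (R : realType) (V : normedModType R) (T : finType) (e : T -> V)
    (c : V -> T -> R) (U : set V) (f : V -> R) (z : V) :
  (forall w, w = \sum_i c w i *: e i) -> (forall w i, `|c w i| <= `|w|) ->
  open U -> U z -> Ck_on 1 U f -> lip_near z f.
Proof.
move=> ce cn oU Uz C1.
pose C := \sum_i (`|'D_(e i) f z| + 1).
have [r r0 Br] : exists2 r : R, 0 < r & forall x, `|x - z| < r ->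
   U x /\ forall i, `|'D_(e i) f x| <= `|'D_(e i) f z| + 1.
  have /nbhs_normP [r r0 H] : nbhs z (U `&` [set x | forall i, `|'D_(e i) f x| <= `|'D_(e i) f z| + 1]).
    apply: filterI; first by move: oU; rewrite openE; apply.
    apply: filter_forall => i.
    have /cvgrPdist_le /(_ _ ltr01) := C1_cont_derive (u := e i) C1 Uz.
    apply: filterS => x; rewrite distrC => H; rewrite -lerBlDl.
    exact: le_trans (lerB_dist _ _) H.
  by exists r => // x xr; apply: (H x); rewrite /ball_ /= distrC.
have C0 : 0 <= C by apply: sumr_ge0 => i _; rewrite addr_ge0.
exists C, r; split => // u v ur vr.
have inb (t : R) : 0 <= t <= 1 -> `|v + t *: (u - v) - z| < r.
  move=> /andP [t0 t1].
  have -> : v + t *: (u - v) - z = (1 - t) *: (v - z) + t *: (u - z).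
    rewrite scalerBl scale1r -(addrA (v - z)) -scalerN -scalerDr opprB.
    by rewrite [z - v + _]addrC addrA subrK addrAC.
  have [->|tn] := eqVneq t 0; first by rewrite subr0 scale1r scale0r addr0.
  have tp : 0 < t by rewrite lt_def tn.
  rewrite (le_lt_trans (ler_normD _ _)) // !normrZ (ger0_norm t0) ger0_norm ?subr_ge0 //.
  have -> : r = (1 - t) * r + t * r by rewrite -mulrDl subrK mul1r.
  by apply: ler_ltD; [rewrite ler_wpM2l ?subr_ge0 // ltW|rewrite ltr_pM2l].
have [t t01] : exists2 t : R, 0 <= t <= 1 & f (v + (u - v)) - f v = 'D_(u - v) f (v + t *: (u - v)).
  by apply: MVT_line => t /inb /Br [Ut _]; apply: C1_derivable C1 Ut.
rewrite (addrC v) subrK => ->.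
have [Ut Dt] := Br _ (inb _ t01).
rewrite [X in 'D_X f _]ce (C1_derive_sum _ _ _ oU Ut C1) mulr_suml.
apply: le_trans (ler_norm_sum _ _ _) _; apply: ler_sum => i _.
by rewrite normrM mulrC ler_pM.
Qed.

Lemma near_dist_lt (R : realType) (V : normedModType R) (z : V) (e : R) :
  0 < e -> \forall u \near z, `|z - u| < e.
Proof. by move=> e0; apply/nbhs_normP; exists e. Qed.

(** * Picard iteration *)

Lemma mx_norm_coord (R : realType) (N : nat) (u : 'rV[R]_N) (i : 'I_N) : `|u 0 i| <= `|u|.
Proof. by rewrite [leRHS]/Num.norm /= mx_normrE; exact: (le_bigmax _ _ (0, i)). Qed.

Lemma mx_norm_le (R : realType) (N : nat) (u : 'rV[R]_N) (e : R) :
  0 <= e -> (forall i, `|u 0 i| <= e) -> `|u| <= e.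
Proof.
move=> e0 ue; rewrite [leLHS]/Num.norm /= mx_normrE bigmax_le //= => -[i j] _.
by rewrite ord1.
Qed.

(** For r >= 0 the nearest-point retraction onto [a - r, a + r]. It is 1-Lipschitz, so composing
    with it extends a function from the interval to the whole line with the same Lipschitz
    constant. *)
Definition clamp (R : realType) (a r x : R) : R := Num.max (a - r) (Num.min (a + r) x).

Lemma clamp_dist (R : realType) (a r x : R) : 0 <= r -> `|clamp a r x - a| <= r.
Proof.
move=> r0; rewrite ler_distl /clamp le_max lexx /= ge_max ge_min lexx /= andbT.
by rewrite lerD2l ge0_cp.
Qed.

Lemma clamp_id (R : realType) (a r x : R) : `|x - a| <= r -> clamp a r x = x.
Proof.
by rewrite ler_distl => /andP [h1 h2]; rewrite /clamp min_r // max_r.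
Qed.

Lemma clamp_lip (R : realType) (a r x y : R) : `|clamp a r x - clamp a r y| <= `|x - y|.
Proof.
wlog xy : x y / x <= y.
  move=> H; case: (leP x y) => [/H //|/ltW /H].
  by rewrite distrC [leRHS]distrC.
rewrite [`|x - y|]distrC [`|y - x|]ger0_norm ?subr_ge0 //.
rewrite /clamp ler_norml.
by case: (leP (a + r) x) => ?; case: (leP (a + r) y) => ?;
  case: (leP (a - r) (a + r)) => ?; case: (leP (a - r) x) => ?;
  case: (leP (a - r) y) => ?; apply/andP; split; lra.
Qed.

(* Based at -1 so that [primitive h] is differentiable on both sides of 0, where
   it vanishes. *)
Definition primitive (R : realType) (h : R -> R) (t : R) : R :=
  (\int[@lebesgue_measure R]_(x in `[(-1)%R, t]) h x) -
  (\int[@lebesgue_measure R]_(x in `[(-1)%R, (0 : R)]) h x).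

Lemma primitive0 (R : realType) (h : R -> R) : primitive h 0 = 0.
Proof. by rewrite /primitive subrr. Qed.

Lemma is_derive_primitive (R : realType) (h : R -> R) (t : R) :
  continuous h -> `|t| < 1 -> is_derive t 1 (primitive h) (h t).
Proof.
move=> ch; rewrite ltr_norml => /andP [t1 t2].
have [|d e] := @continuous_FTC1_closed R h (-1) t 1 t2 _ t1 (ch t).
  apply: continuous_compact_integrable; first exact: segment_compact.
  exact: continuous_subspaceT.
rewrite -[h t]subr0; apply: is_deriveB.
by rewrite -e derive1E; exact: derivableP.
Qed.

Lemma mvt_lip (R : realType) (H h : R -> R) (d B s t : R) :
  (forall x : R, `|x| < d -> is_derive x 1 H (h x)) ->
  (forall x : R, `|x| < d -> `|h x| <= B) ->
  `|s| < d -> `|t| < d -> `|H t - H s| <= B * `|t - s|.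
Proof.
move=> dH hB.
wlog st : s t / s <= t.
  move=> W; case: (leP s t) => [/W //|/ltW /W {}W] sd td.
  by rewrite distrC [`|t - s|]distrC; exact: W.
rewrite !ltr_norml => /andP [s1 s2] /andP [t1 t2].
have inb (x : R) : x \in `[s, t] -> `|x| < d.
  rewrite in_itv /= => /andP [sx xt].
  by rewrite ltr_norml (lt_le_trans s1 sx) (le_lt_trans xt t2).
have d1 (x : R) : x \in `]s, t[ -> is_derive x 1 H (h x).
  by move=> xi; apply/dH/inb; exact: subset_itv_oo_cc.
have c1 : {within `[s, t], continuous H}.
  by apply: derivable_within_continuous => x /inb /dH [].
have [c /inb ci ->] := MVT_segment st d1 c1.
by rewrite normrM ler_wpM2r // hB.
Qed.

(** Nested intervals: the radius 2 C / 2^k decreases by exactly C / 2^k, the largest possible move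
    of the centre. The limit is the supremum of the left ends. *)
Lemma geometric_limit (R : realType) (a : nat -> R) (C : R) :
  (forall k, `|a k.+1 - a k| <= C / 2 ^+ k) ->
  exists l, forall k, `|l - a k| <= 2 * C / 2 ^+ k.
Proof.
move=> aC; pose b k := a k - 2 * C / 2 ^+ k; pose c k := a k + 2 * C / 2 ^+ k.
have E k : 2 * C / 2 ^+ k.+1 = C / 2 ^+ k.
  by rewrite exprS invfM mulrACA divff ?mul1r // pnatr_eq0.
have E2 k : 2 * C / 2 ^+ k = C / 2 ^+ k + C / 2 ^+ k by ring.
have b1 k : b k <= b k.+1.
  by rewrite /b E E2; move: (aC k); rewrite ler_norml; lra.
have c1 k : c k.+1 <= c k.
  by rewrite /c E E2; move: (aC k); rewrite ler_norml; lra.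
have bh : {homo b : m n / (m <= n)%N >-> m <= n} by apply: homo_leq => // x y z; exact: le_trans.
have ch m n : (m <= n)%N -> c n <= c m.
  move=> mn; have := @homo_leq _ c (fun x y => y <= x); apply => //.
  by move=> x y z yx xz; exact: le_trans yx.
have C0 : 0 <= C by have := aC 0%N; rewrite expr0 divr1; apply: le_trans.
have bc k : b k <= c k.
  have : 0 <= C / 2 ^+ k by rewrite divr_ge0 // exprn_ge0.
  rewrite /b /c E2; lra.
have bjc j k : b j <= c k.
  have [jk|/ltnW kj] := leqP j k.
    exact: le_trans (bh _ _ jk) (bc k).
  exact: le_trans (bc j) (ch _ _ kj).
exists (sup (range b)) => k; rewrite ler_distl -/(b k) -/(c k); apply/andP; split.
  apply: ub_le_sup; last by exists k.
  by exists (c k) => _ [j _ <-].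
apply: ge_sup; first by exists (b 0%N), 0%N.
by move=> _ [j _ <-].
Qed.

Lemma le_geometric_eq0 (R : realType) (x K : R) :
  (forall k : nat, `|x| <= K / 2 ^+ k) -> x = 0.
Proof.
move=> xK; apply/eqP; rewrite -normr_le0 leNgt; apply/negP => x0.
have K0 : 0 <= K by have := xK 0%N; rewrite expr0 divr1; apply: le_trans.
have [k] : exists k : nat, K / `|x| < k%:R.
  exists (Num.truncn (K / `|x|)).+1.
  by rewrite truncnS_gt // num_real.
rewrite ltr_pdivrMr // => Kk.
have := xK k; rewrite ler_pdivlMr ?exprn_gt0 // mulrC leNgt => /negP; apply.
apply: lt_trans Kk _; rewrite ltr_pM2r // -natrX ltr_nat.
exact: ltn_expl.
Qed.

Section Picard.
Variables (R : realType) (N : nat) (f : 'rV[R]_N -> 'rV[R]_N) (L M : R) (z0 : 'rV[R]_N).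
Hypothesis L0 : 0 <= L.
Hypothesis M0 : 0 <= M.
Hypothesis fL : forall u v, `|f u - f v| <= L * `|u - v|.
Hypothesis fM : forall u, `|f u| <= M.

(** With this radius L d <= 1/2, which is the contraction factor, and d < 1, so that clamped times
    stay where [primitive] is differentiable; L + 1 in place of L also serves L = 0. *)
Let d : R := (2 * (L + 1))^-1.

Let L1 : 0 < 2 * (L + 1). Proof. by rewrite mulr_gt0 // ltr_wpDl. Qed.
Let d0 : 0 < d. Proof. by rewrite invr_gt0. Qed.
Let d1 : d < 1. Proof. rewrite invf_lt1 //; move: L0; lra. Qed.
Let Ld : L * d <= 2^-1.
Proof. rewrite ler_pdivrMr // ; move: L0; lra. Qed.

(** The M-Lipschitz curves: [Phi] preserves this class because f is bounded by M, and within it the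
    integrands are continuous. *)
Let good (u : R -> 'rV[R]_N) := forall s t, `|u s - u t| <= M * `|s - t|.

(* Clamping the time makes the Picard operator a contraction for the sup norm on
   the whole line. *)
Let Phi (u : R -> 'rV[R]_N) (t : R) : 'rV[R]_N :=
  z0 + \row_i primitive (fun s => f (u s) 0 i) (clamp 0 d t).

Lemma good_cont u i : good u -> continuous (fun s => f (u s) 0 i).
Proof.
move=> gu t; apply/cvgrPdist_le => e e0.
have LM0 : 0 <= L * M by rewrite mulr_ge0.
near=> s.
apply: (@le_trans _ _ (L * (M * `|t - s|))).
  have := mx_norm_coord (f (u t) - f (u s)) i; rewrite !mxE => /le_trans; apply.
  by apply: le_trans (fL _ _) _; rewrite ler_wpM2l.
rewrite mulrA.
apply: (@le_trans _ _ ((L * M + 1) * `|t - s|)).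
  by rewrite ler_wpM2r // lerDl.
rewrite mulrC -ler_pdivlMr ?ltr_wpDl //.
apply/ltW; near: s; apply: (@near_dist_lt R R).
by rewrite divr_gt0 // ltr_wpDl.
Unshelve. all: by end_near. Qed.

Lemma clamp_d t : `|clamp 0 d t| <= d.
Proof. by have := clamp_dist 0 t (ltW d0); rewrite subr0. Qed.

Lemma clamp_1 t : `|clamp 0 d t| < 1.
Proof. exact: le_lt_trans (clamp_d t) d1. Qed.

Lemma good_Phi u : good u -> good (Phi u).
Proof.
move=> gu s t; rewrite /Phi opprD addrACA subrr add0r.
apply: mx_norm_le => [|i]; first by rewrite mulr_ge0.
rewrite !mxE.
apply: le_trans (_ : M * `|clamp 0 d s - clamp 0 d t| <= _); last first.
  by rewrite ler_wpM2l // clamp_lip.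
apply: (@mvt_lip _ _ (fun s => f (u s) 0 i) 1); try exact: clamp_1.
  by move=> x; apply: is_derive_primitive; exact: good_cont.
by move=> x _; apply: le_trans (mx_norm_coord _ _) (fM _).
Qed.

(** The two primitives agree at 0, so their difference at a clamped time is at most L B d, hence at
    most B / 2. *)
Lemma Phi_contr u v (B : R) : good u -> good v -> 0 <= B ->
  (forall t, `|u t - v t| <= B) -> forall t, `|Phi u t - Phi v t| <= B / 2.
Proof.
move=> gu gv B0 uvB t; rewrite /Phi opprD addrACA subrr add0r.
apply: mx_norm_le => [|i]; first by rewrite divr_ge0.
rewrite !mxE; set a := clamp 0 d t.
pose H := primitive (fun s => f (u s) 0 i) - primitive (fun s => f (v s) 0 i).
have := @mvt_lip R H (fun s => f (u s) 0 i - f (v s) 0 i) 1 (L * B) 0 a.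
rewrite /H /= -![(_ - _) _]/(_ - _) !primitive0 !subr0; move=> /(_ _ _ _ _)/le_trans; apply.
- by move=> x x1; apply: is_deriveB; apply: is_derive_primitive => //; exact: good_cont.
- move=> x _; have := mx_norm_coord (f (u x) - f (v x)) i; rewrite !mxE => /le_trans; apply.
  by apply: le_trans (fL _ _) _; rewrite ler_wpM2l.
- by rewrite normr0.
- exact: clamp_1.
- rewrite mulrAC mulrC ler_wpM2l //; apply: le_trans Ld.
  by rewrite ler_wpM2l // clamp_d.
Qed.

(** The iterates move by at most M / 2^k, uniformly in time. That the limit is M-Lipschitz and a
    fixed point of [Phi] holds up to errors of order 2^-k for every k, hence exactly. For |t| < d
    the clamp is the identity near t, and the fixed-point equation can be differentiated. *)
Lemma picard_global : exists u : R -> 'rV[R]_N,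
  u 0 = z0 /\ exists2 r : R, 0 < r & forall t : R, `|t| < r ->
    (forall i, is_derive t 1 (fun s => u s 0 i) (f (u t) 0 i)).
Proof.
pose a k := iter k Phi (fun=> z0).
have ga k : good (a k).
  elim: k => [|k IH]; last exact: good_Phi.
  by move=> s t; rewrite /a /= subrr normr0 mulr_ge0.
have Phi0 u : Phi u 0 = z0.
  apply/rowP => i; rewrite !mxE clamp_id ?primitive0 ?addr0 //.
  by rewrite subr0 normr0 ltW.
have Phic u t : Phi u t = Phi u (clamp 0 d t).
  by rewrite /Phi (clamp_id (x := clamp 0 d t)) // subr0 clamp_d.
have aa k t : `|a k.+1 t - a k t| <= M / 2 ^+ k.
  elim: k t => [|k IH] t.
    rewrite expr0 divr1 /= Phic -[X in _ - X](Phi0 (fun=> z0)).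
    have := good_Phi (ga 0%N) (clamp 0 d t) 0; move=> /le_trans; apply.
    by rewrite subr0 ler_piMr // ltW // clamp_1.
  have -> : M / 2 ^+ k.+1 = M / 2 ^+ k / 2 by rewrite exprS invfM mulrCA mulrC.
  apply: (Phi_contr (ga k.+1) (ga k) _ IH).
  by rewrite divr_ge0 // exprn_ge0.
have [u uP] : exists u : R -> 'rV[R]_N, forall t k, `|u t - a k t| <= 2 * M / 2 ^+ k.
  have /choice [u uP] : forall t, exists ut : 'rV[R]_N, forall k, `|ut - a k t| <= 2 * M / 2 ^+ k.
    move=> t; have /choice [l lP] : forall i, exists l, forall k, `|l - a k t 0 i| <= 2 * M / 2 ^+ k.
      move=> i; apply: geometric_limit => k; apply: le_trans (aa k t).
      by have := mx_norm_coord (a k.+1 t - a k t) i; rewrite !mxE.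
    exists (\row_i l i) => k; apply: mx_norm_le => [|i]; last by rewrite !mxE.
    by rewrite divr_ge0 ?mulr_ge0 // exprn_ge0.
  by exists u.
have M2 k : 0 <= 2 * M / 2 ^+ k by rewrite divr_ge0 ?mulr_ge0 // exprn_ge0.
have gu : good u.
  move=> s t; rewrite leNgt; apply/negP; rewrite -subr_gt0 => lt0.
  suff : `|u s - u t| - M * `|s - t| = 0 by move/eqP; rewrite gt_eqF.
  apply: (@le_geometric_eq0 _ _ (4 * M)) => k; rewrite gtr0_norm //.
  have -> : u s - u t = (u s - a k s) + (a k s - a k t) - (u t - a k t).
    by rewrite addrA subrK opprB addrA subrK.
  rewrite lerBlDr (le_trans (ler_normB _ _)) //.
  have := ler_normD (u s - a k s) (a k s - a k t).
  have := uP s k; have := uP t k; have := ga k s t; lra.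
have uE t : u t = Phi u t.
  apply/eqP; rewrite -subr_eq0; apply/eqP; apply/rowP => i; rewrite [RHS]mxE.
  apply: (@le_geometric_eq0 _ _ (2 * M)) => k.
  apply: le_trans (mx_norm_coord _ _) _.
  have -> : u t - Phi u t = (u t - a k.+1 t) + (Phi (a k) t - Phi u t).
    by rewrite addrA subrK.
  have h1 := uP t k.+1.
  have h2 := Phi_contr (ga k) gu (M2 k) _ t.
  apply: le_trans (ler_normD _ _) _.
  have {}h2 : `|Phi (a k) t - Phi u t| <= 2 * M / 2 ^+ k / 2.
    by apply: h2 => s; rewrite distrC.
  have E : 2 * M / 2 ^+ k.+1 = 2 * M / 2 ^+ k / 2 by rewrite exprS invfM mulrCA mulrC.
  rewrite E in h1; have := M2 k; lra.
exists u; split; first by rewrite uE Phi0.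
exists d => // t td i.
apply: (@near_eq_is_derive _ _ _ (cst (z0 0 i) + primitive (fun s => f (u s) 0 i))).
  near=> s; rewrite [in RHS]uE !mxE clamp_id // subr0.
  have ts : `|t - s| < d - `|t| by near: s; apply: (@near_dist_lt R R); rewrite subr_gt0.
  rewrite -[s](subKr t); apply: le_trans (ler_normB _ _) _.
  by rewrite -lerBrDl ltW.
rewrite -[f (u t) 0 i]add0r; apply: is_deriveD.
by apply: is_derive_primitive; [exact: good_cont|exact: lt_trans d1].
Unshelve. all: by end_near. Qed.

End Picard.

(** * Locally Lipschitz functions *)

Section LipNear.
Variables (R : realType) (V : normedModType R) (z : V).
Implicit Types h k : V -> R.

Lemma lip_near_cst (c : R) : lip_near z (fun=> c).
Proof. by exists 0, 1; split => // u v _ _; rewrite subrr normr0 mul0r. Qed.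

Lemma lip_near_join h k : lip_near z h -> lip_near z k ->
  exists L r : R, [/\ 0 <= L, 0 < r & forall u v, `|u - z| < r -> `|v - z| < r ->
    `|h u - h v| <= L * `|u - v| /\ `|k u - k v| <= L * `|u - v|].
Proof.
move=> [L [r [L0 r0 H]]] [L' [r' [L'0 r'0 K]]].
exists (L + L'), (Num.min r r'); split; first exact: addr_ge0.
  by rewrite lt_min r0.
move=> u v; rewrite !lt_min => /andP [ur ur'] /andP [vr vr']; split.
  by rewrite (le_trans (H _ _ ur vr)) // ler_wpM2r // lerDl.
by rewrite (le_trans (K _ _ ur' vr')) // ler_wpM2r // lerDr.
Qed.

Lemma lip_nearD h k : lip_near z h -> lip_near z k -> lip_near z (fun u => h u + k u).
Proof.
move=> /lip_near_join H /H [L [r [L0 r0 {}H]]].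
exists (L + L), r; split => // [|u v ur vr]; first exact: addr_ge0.
have [hu ku] := H _ _ ur vr.
by rewrite opprD addrACA mulrDl (le_trans (ler_normD _ _)) // lerD.
Qed.

Lemma lip_near_bound h : lip_near z h ->
  exists B r : R, [/\ 0 <= B, 0 < r & forall u, `|u - z| < r -> `|h u| <= B].
Proof.
move=> [L [r [L0 r0 H]]]; exists (`|h z| + L * r), r; split => // [|u ur].
  by rewrite addr_ge0 // mulr_ge0 // ltW.
rewrite -lerBlDl; apply: le_trans (lerB_dist _ _) _.
apply: le_trans (H _ _ ur _) _; first by rewrite subrr normr0.
by rewrite ler_wpM2l // ltW.
Qed.

Lemma lip_nearM h k : lip_near z h -> lip_near z k -> lip_near z (fun u => h u * k u).
Proof.
move=> lh lk; have [L [r [L0 r0 H]]] := lip_near_join lh lk.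
have [B [s [B0 s0 hB]]] := lip_near_bound lh.
have [C [t [C0 t0 kC]]] := lip_near_bound lk.
exists (B * L + C * L), (Num.min r (Num.min s t)); split.
- by rewrite addr_ge0 // mulr_ge0.
- by rewrite !lt_min r0 s0.
move=> u v; rewrite !lt_min => /and3P [ur us ut] /and3P [vr vs vt].
have [hu ku] := H _ _ ur vr.
have -> : h u * k u - h v * k v = h u * (k u - k v) + k v * (h u - h v) by ring.
rewrite (le_trans (ler_normD _ _)) // !normrM mulrDl -!mulrA.
by rewrite lerD // ler_pM // ?hB // ?kC.
Qed.

Lemma lip_nearN h : lip_near z h -> lip_near z (fun u => - h u).
Proof.
by move=> [L [r [L0 r0 H]]]; exists L, r; split => // u v ur vr; rewrite -opprD normrN H.
Qed.

Lemma lip_near_sum (T : Type) (s : seq T) (P : pred T) (h : T -> V -> R) :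
  (forall i, lip_near z (h i)) -> lip_near z (fun u => \sum_(i <- s | P i) h i u).
Proof.
move=> H; elim: s => [|i s IH].
  by under eq_fun do rewrite big_nil; exact: lip_near_cst.
under eq_fun do rewrite big_cons.
by case: (P i) => //; exact: lip_nearD.
Qed.

Lemma lip_near_prod (T : Type) (s : seq T) (P : pred T) (h : T -> V -> R) :
  (forall i, lip_near z (h i)) -> lip_near z (fun u => \prod_(i <- s | P i) h i u).
Proof.
move=> H; elim: s => [|i s IH].
  by under eq_fun do rewrite big_nil; exact: lip_near_cst.
under eq_fun do rewrite big_cons.
by case: (P i) => //; exact: lip_nearM.
Qed.

Lemma lip_near_neq0 h : lip_near z h -> h z != 0 ->
  exists B r : R, [/\ 0 < B, 0 < r & forall u, `|u - z| < r -> B <= `|h u|].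
Proof.
move=> [L [r [L0 r0 H]]] hz.
have hz0 : 0 < `|h z| by rewrite normr_gt0.
have L1 : 0 < L + 1 by rewrite ltr_wpDl.
exists (`|h z| / 2), (Num.min r (`|h z| / 2 / (L + 1))); split.
- by rewrite divr_gt0.
- by rewrite lt_min r0 !divr_gt0.
move=> u; rewrite lt_min ltr_pdivlMr // => /andP [ur uh].
have := H z u; rewrite subrr normr0 => /(_ r0 ur) H1.
have := lerB_dist (h z) (h u); have := normr_ge0 (u - z).
rewrite distrC in H1; move: H1 uh; rewrite (distrC (h u)) (distrC z).
nra.
Qed.

Lemma lip_nearV h : lip_near z h -> h z != 0 -> lip_near z (fun u => (h u)^-1).
Proof.
move=> lh hz; have [B [s [B0 s0 hB]]] := lip_near_neq0 lh hz.
case: lh => [L [r [L0 r0 H]]].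
exists (L / (B * B)), (Num.min r s); split.
- by rewrite divr_ge0 // mulr_ge0 // ltW.
- by rewrite !lt_min r0 s0.
move=> u v; rewrite !lt_min => /andP [ur us] /andP [vr vs].
have hu : 0 < `|h u| by apply: lt_le_trans B0 (hB _ us).
have hv : 0 < `|h v| by apply: lt_le_trans B0 (hB _ vs).
have -> : (h u)^-1 - (h v)^-1 = (h v - h u) / (h u * h v).
  by field; rewrite -!normr_gt0 hu hv.
rewrite normrM normfV normrM distrC mulrAC.
rewrite ler_pM ?invr_ge0 ?H ?mulr_ge0 // lef_pV2 ?posrE ?mulr_gt0 //.
by rewrite ler_pM // ?hB // ltW.
Qed.

Lemma near_lip_near h k : (\near z, h z = k z) -> lip_near z h -> lip_near z k.
Proof.
move=> /nbhs_normP [s s0 hk] [L [r [L0 r0 H]]].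
exists L, (Num.min r s); split => //; first by rewrite lt_min r0.
move=> u v; rewrite !lt_min => /andP [ur us] /andP [vr vs].
by rewrite -!hk ?H // /ball_ /= distrC.
Qed.

Lemma lip_near_det N (A : V -> 'M[R]_N) :
  (forall i j, lip_near z (fun u => A u i j)) -> lip_near z (fun u => \det (A u)).
Proof.
move=> H; apply: lip_near_sum => s; apply: lip_nearM; first exact: lip_near_cst.
exact: lip_near_prod.
Qed.

(** Near z the determinant stays away from 0, so [invmx] is there given by Cramer's formula and not
    by its default value, the matrix itself. *)
Lemma lip_near_invmx N (A : V -> 'M[R]_N) i j :
  (forall i j, lip_near z (fun u => A u i j)) -> \det (A z) != 0 ->
  lip_near z (fun u => invmx (A u) i j).
Proof.
move=> H dz; have ld := lip_near_det H.
apply: (@near_lip_near (fun u => (\det (A u))^-1 * cofactor (A u) j i)).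
  have [B [r [B0 r0 hB]]] := lip_near_neq0 ld dz.
  apply/nbhs_normP; exists r => // u; rewrite /ball_ /= distrC => ur.
  rewrite /invmx unitmxE unitfE -normr_gt0 (lt_le_trans B0 (hB _ ur)).
  by rewrite !mxE.
apply: lip_nearM; first exact: lip_nearV.
apply: lip_nearM; first exact: lip_near_cst.
by apply: lip_near_det => k l; under eq_fun do rewrite !mxE.
Qed.

End LipNear.

Lemma lip_near_uniform (R : realType) (V : normedModType R) (z : V) (T : finType)
    (h : T -> V -> R) : (forall i, lip_near z (h i)) ->
  exists L r : R, [/\ 0 <= L, 0 < r & forall i u v, `|u - z| < r -> `|v - z| < r ->
    `|h i u - h i v| <= L * `|u - v|].
Proof.
move=> /choice [L /choice [r H]].
have L0 i : 0 <= L i by case: (H i).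
exists (\sum_i L i), (\big[Num.min/1]_i r i); split; first exact: sumr_ge0.
  by elim/big_ind: _ => // [x y x0 y0|i _]; [rewrite lt_min x0|case: (H i)].
move=> i u v ur vr; have [_ _ Hi] := H i.
have ri : \big[Num.min/1]_i r i <= r i by exact: bigmin_le_cond.
apply: le_trans (Hi _ _ (lt_le_trans ur ri) (lt_le_trans vr ri)) _.
by rewrite ler_wpM2r // (bigD1 i) //= lerDl sumr_ge0.
Qed.

(** Precomposing f with the clamping [box] onto the cube of half-side r / 2 makes it globally
    Lipschitz and bounded; r / 2 keeps the cube inside the open ball where the estimate holds. By
    continuity the solution remains in the cube for a short time, and there [box] is the
    identity. *)
Lemma picard_local (R : realType) (N : nat) (f : 'rV[R]_N -> 'rV[R]_N) (z0 : 'rV[R]_N) :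
  (forall i, lip_near z0 (fun u => f u 0 i)) ->
  exists u : R -> 'rV[R]_N, u 0 = z0 /\ exists2 r : R, 0 < r & forall t : R, `|t| < r ->
    forall i, is_derive t 1 (fun s => u s 0 i) (f (u t) 0 i).
Proof.
move=> /lip_near_uniform [L [r [L0 r0 H]]].
have r20 : 0 < r / 2 by rewrite divr_gt0.
pose box (u : 'rV[R]_N) : 'rV[R]_N := \row_i clamp (z0 0 i) (r / 2) (u 0 i).
have boxr u : `|box u - z0| <= r / 2.
  by apply: mx_norm_le => [|i]; rewrite ?mxE ?clamp_dist // ltW.
have boxlip u v : `|box u - box v| <= `|u - v|.
  apply: mx_norm_le => // i; rewrite !mxE (le_trans (clamp_lip _ _ _ _)) //.
  by have := mx_norm_coord (u - v) i; rewrite !mxE.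
have boxid (u : 'rV[R]_N) : (forall i, `|u 0 i - z0 0 i| <= r / 2) -> box u = u.
  by move=> ur; apply/rowP => i; rewrite mxE clamp_id.
have boxlt u : `|box u - z0| < r.
  by apply: le_lt_trans (boxr u) _; rewrite ltr_pdivrMr // mulr_natr mulr2n ltrDl.
have fL u v : `|f (box u) - f (box v)| <= L * `|u - v|.
  apply: mx_norm_le => [|i]; first by rewrite mulr_ge0.
  by rewrite !mxE (le_trans (H _ _ _ _ _)) // ler_wpM2l.
have fM u : `|f (box u)| <= `|f z0| + L * (r / 2).
  rewrite -lerBlDl; apply: le_trans (lerB_dist _ _) _.
  have <- : box z0 = z0 by apply: boxid => i; rewrite subrr normr0 ltW.
  apply: mx_norm_le => [|i]; first by rewrite mulr_ge0 // ltW.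
  rewrite !mxE (le_trans (H _ _ _ _ _)) // ler_wpM2l //.
  by rewrite (boxid z0) // => j; rewrite subrr normr0 ltW.
have M0 : 0 <= `|f z0| + L * (r / 2) by rewrite addr_ge0 // mulr_ge0 // ltW.
have [u [u0 [d d0 ud]]] := picard_global z0 L0 M0 fL fM.
exists u; split => //.
have : \forall t \near (0 : R), forall i, `|u t 0 i - z0 0 i| <= r / 2.
  apply: (@filter_forall _ _ _ _ (nbhs_filter (0 : R))) => i.
  have [] := ud 0 _ i; first by rewrite normr0.
  move=> + _ => /derivable1_diffP /differentiable_continuous.
  move=> /cvgrPdist_le /(_ _ r20); apply: filterS => t.
  by rewrite u0 distrC.
move=> /nbhs_normP [e e0 ue]; exists (Num.min d e); first by rewrite lt_min d0.
move=> t; rewrite lt_min => /andP [td te] i.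
have := ud t td i; rewrite boxid // => j.
by apply: ue; rewrite /ball_ /= sub0r normrN.
Qed.

(** * Polarization of forms vanishing on an open set *)

(** The sum factors over q. If q is not a value of f, the bit b q enters only through its sign and
    gives 1 - 1 = 0; if it is a value, the bit must be 1 and the factor is -1. The value [None] of f
    stands for the choice of the base point y in the r-th factor. *)
Lemma alternating_choice_sum (R : comNzRingType) (N : nat) (f : {ffun 'I_N -> option 'I_N}) :
  \sum_(b : {ffun 'I_N -> bool}) (\prod_q (-1) ^+ b q) *
     \prod_r (if f r is Some q then (b q)%:R else 1) =
  (if [forall q, exists r, f r == Some q] then (-1) ^+ N else 0) :> R.
Proof.
pose F q (bq : bool) : R := (-1) ^+ bq * ([exists r, f r == Some q] ==> bq)%:R.
transitivity (\sum_(b : {ffun 'I_N -> bool}) \prod_q F q (b q)).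
  apply: eq_bigr => b _; rewrite big_split /=; congr (_ * _).
  have [/forallP H|] := boolP [forall q, [exists r, f r == Some q] ==> b q].
    rewrite !big1 // => [q _|r _]; first by rewrite H.
    case E : (f r) => [q|//].
    have := H q; rewrite (_ : [exists _, _]) ?implyTb => [->//|].
    by apply/existsP; exists r; rewrite E.
  rewrite negb_forall => /existsP [q]; rewrite negb_imply => /andP [fq bq].
  rewrite [RHS](bigD1 q) //= fq (negbTE bq) /= mul0r.
  have /existsP [r /eqP fr] := fq.
  by rewrite (bigD1 r) //= fr (negbTE bq) mul0r.
rewrite -(bigA_distr_bigA F) /=.
have FE q : \sum_(j : bool) F q j = (if [exists r, f r == Some q] then -1 else 0).
  rewrite big_bool /F expr1 expr0 /=.
  by case: [exists r, _]; rewrite /= ?mulr1 ?mulr0 ?addr0 // addNr.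
under eq_bigr do rewrite FE.
have [/forallP H|] := boolP [forall q, exists r, f r == Some q].
  by under eq_bigr do rewrite H; rewrite prodr_const card_ord.
rewrite negb_forall => /existsP [q fq].
by rewrite (bigD1 q) //= (negbTE fq) mul0r.
Qed.

(** A right inverse [p] of such an f is an injection of a finite set into itself, hence a
    permutation. So f is [Some] after the inverse of [p] and never takes the value [None]. *)
Lemma sum_onto_Some (R : comNzRingType) (N : nat) (G : {ffun 'I_N -> option 'I_N} -> R) :
  \sum_(f : {ffun 'I_N -> option 'I_N} | [forall q, exists r, f r == Some q]) G f =
  \sum_(s : 'S_N) G [ffun r => Some (s r)].
Proof.
pose h (s : 'S_N) : {ffun 'I_N -> option 'I_N} := [ffun r => Some (s r)].
have hinj : injective h.
  move=> s t /ffunP st; apply/permP => r.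
  by have := st r; rewrite !ffunE => -[].
have -> : \sum_(s : 'S_N) G (h s) = \sum_(f in h @: [set: 'S_N]%SET) G f.
  rewrite big_imset /=; last by move=> s t _ _; exact: hinj.
  by apply: eq_bigl => s; rewrite finset.in_setT.
apply: eq_bigl => f; apply/forallP/imsetP => [H|[s _ ->] q]; last first.
  by apply/existsP; exists ((s^-1)%g q); rewrite ffunE permKV.
have /fin_all_exists [p fp] : forall q, exists r, f r = Some q.
  by move=> q; have /existsP [r /eqP] := H q; exists r.
have pinj : injective p by move=> q q' pq; have := fp q; rewrite pq fp => -[].
exists ((perm pinj)^-1)%g; rewrite ?inE //.
apply/ffunP => r; rewrite ffunE.
by rewrite -[in LHS](permKV (perm pinj) r) permE fp.
Qed.

(* Expanding each factor, a choice of summands contributes only if every [w q]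
   is chosen, hence exactly once and with no factor [y]: see
   [alternating_choice_sum]. *)
Lemma polarization_identity (R : comNzRingType) (N n : nat)
    (T : {ffun 'I_N -> 'I_n} -> R) (y : 'I_n -> R) (w : 'I_N -> 'I_n -> R) :
  \sum_(b : {ffun 'I_N -> bool}) (\prod_q (-1) ^+ b q) *
    (\sum_K T K * \prod_r (y (K r) + \sum_q (b q)%:R * w q (K r))) =
  (-1) ^+ N * \sum_(s : 'S_N) \sum_K T K * \prod_r w (s r) (K r).
Proof.
pose a (K : {ffun 'I_N -> 'I_n}) r (o : option 'I_N) : R :=
  if o is Some q then w q (K r) else y (K r).
have E (K : {ffun 'I_N -> 'I_n}) (b : {ffun 'I_N -> bool}) :
    \prod_r (y (K r) + \sum_q (b q)%:R * w q (K r)) =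
    \sum_(f : {ffun 'I_N -> option 'I_N})
      \prod_r ((if f r is Some q then (b q)%:R else 1) * a K r (f r)).
  rewrite -(bigA_distr_bigA (fun r o => (if o is Some q then (b q)%:R else 1) * a K r o)).
  apply: eq_bigr => r _; rewrite (bigD1 None) //= mul1r; congr (_ + _).
  rewrite (reindex_omap Some id) /=; last by case.
  by apply: eq_big => [q|q _]; rewrite ?eqxx.
transitivity (\sum_K \sum_(b : {ffun 'I_N -> bool}) (\prod_q (-1) ^+ b q) *
    (T K * \prod_r (y (K r) + \sum_q (b q)%:R * w q (K r)))).
  by rewrite exchange_big; apply: eq_bigr => b _; rewrite big_distrr.
rewrite [in RHS]exchange_big /= big_distrr /=; apply: eq_bigr => K _.
transitivity (\sum_(b : {ffun 'I_N -> bool}) \sum_(f : {ffun 'I_N -> option 'I_N})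
    T K * \prod_r a K r (f r) *
    ((\prod_q (-1) ^+ b q) * \prod_r (if f r is Some q then (b q)%:R else 1))).
  apply: eq_bigr => b _; rewrite E !big_distrr /=; apply: eq_bigr => f _.
  by rewrite big_split /=; ring.
rewrite exchange_big /=; under eq_bigr do rewrite -big_distrr alternating_choice_sum /=.
transitivity (\sum_(f : {ffun 'I_N -> option 'I_N} | [forall q, exists r, f r == Some q])
    T K * \prod_r a K r (f r) * (-1) ^+ N).
  by rewrite [RHS]big_mkcond; apply: eq_bigr => f _; case: ifP; rewrite ?mulr0.
rewrite sum_onto_Some big_distrr /=; apply: eq_bigr => s _; rewrite mulrC.
by congr (_ * (_ * _)); apply: eq_bigr => r _; rewrite ffunE.
Qed.

(** Polarization with w q equal to t times the basis vector of index K0 q. Every point of the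
    alternating sum lies in the ball, since N t < e for t = e / (N + 1), so the left side vanishes;
    on the right the products of the w's single out the coefficients T at the permutations of K0,
    each with the factor t^N. *)
Lemma form_eq0_near_symm_eq0 (R : realType) (N n : nat)
    (T : {ffun 'I_N -> 'I_n} -> R) (y : 'rV[R]_n) (e : R) :
  0 < e ->
  (forall y' : 'rV[R]_n, `|y' - y| < e -> \sum_K T K * \prod_r y' 0 (K r) = 0) ->
  forall K0 : {ffun 'I_N -> 'I_n}, \sum_(s : 'S_N) T [ffun r => K0 (s r)] = 0.
Proof.
move=> e0 Ty K0; pose t := e / N.+1%:R.
have t0 : 0 < t by rewrite divr_gt0.
pose w (q : 'I_N) (i : 'I_n) : R := t * (i == K0 q)%:R.
have := polarization_identity T (fun i => y 0 i) w.
rewrite big1 => [|b _]; last first.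
  pose y' : 'rV[R]_n := y + \row_i \sum_q (b q)%:R * w q i.
  have : \sum_K T K * \prod_r y' 0 (K r) = 0.
    apply: Ty; rewrite /y' addrAC subrr add0r.
    apply: (@le_lt_trans _ _ (t *+ N)); last first.
      by rewrite -mulr_natr /t mulrAC -mulrA gtr_pMr // ltr_pdivrMr // mul1r ltr_nat.
    apply: mx_norm_le => [|i]; first by rewrite mulrn_wge0 // ltW.
    rewrite mxE; apply: le_trans (ler_norm_sum _ _ _) _.
    rewrite -[leRHS](_ : \sum_(q < N) t = _); last by rewrite sumr_const card_ord.
    apply: ler_sum => q _.
    have -> : (b q)%:R * w q i = (b q && (i == K0 q))%:R * t.
      by rewrite /w mulrCA mulrC -natrM mulnb.
    case: (_ && _); first by rewrite mul1r gtr0_norm.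
    by rewrite mul0r normr0 ltW.
  move=> H; rewrite -[X in _ * X]/(\sum_K _) -[RHS](mulr0 (\prod_q (-1) ^+ b q)).
  congr (_ * _); rewrite -[RHS]H; apply: eq_bigr => K _; congr (_ * _).
  by apply: eq_bigr => r _; rewrite !mxE.
move=> /esym /eqP; rewrite mulf_eq0 signr_eq0 /= => /eqP H.
have E s : \sum_K T K * \prod_r w (s r) (K r) = T [ffun r => K0 (s r)] * t ^+ N.
  rewrite (bigD1 [ffun r => K0 (s r)]) //= [X in _ + X]big1 => [|K KK0].
    rewrite addr0; congr (_ * _).
    under eq_bigr do rewrite ffunE /w eqxx mulr1.
    by rewrite prodr_const card_ord.
  have /existsP [r Kr] : [exists r, K r != K0 (s r)].
    rewrite -negb_forall; apply: contra KK0 => /forallP H'.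
    by apply/eqP/ffunP => r; rewrite ffunE; apply/eqP.
  by rewrite (bigD1 r) //= /w (negbTE Kr) mulr0 mul0r mulr0.
move: H; under eq_bigr do rewrite E.
move/eqP; rewrite -mulr_suml mulf_eq0 expf_eq0 (gt_eqF t0) andbF orbF.
by move/eqP.
Qed.

(** * Forms with variable coefficients *)

Lemma is_derive_additive (R : realType) (V : normedModType R) (f : V -> R) (z v : V) (l : R) :
  (forall h : R, f (h *: v + z) = h * l + f z) -> is_derive z v f l.
Proof.
move=> fE.
have E : (fun h : R => h^-1 *: ((f \o shift z) (h *: v) - f z)) @ 0^' --> l.
  apply: cvg_near_cst; near=> h.
  have h0 : h != 0 by near: h; exact: nbhs_dnbhs_neq.
  by rewrite /= fE addrK /GRing.scale /= mulKf.
split; first by apply/cvg_ex; exists l.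
exact/cvg_lim.
Unshelve. all: by end_near. Qed.

Lemma is_derive_fst (R : realType) (V W : normedModType R) (g : V -> R) (z v : V * W) (l : R) :
  is_derive z.1 v.1 g l -> is_derive z v (fun w => g w.1) l.
Proof. by move=> [d e]; split; [exact: d|exact: e]. Qed.

Lemma is_derive_snd (R : realType) (V W : normedModType R) (g : W -> R) (z v : V * W) (l : R) :
  is_derive z.2 v.2 g l -> is_derive z v (fun w => g w.2) l.
Proof. by move=> [d e]; split; [exact: d|exact: e]. Qed.

Lemma is_derive_bigsum (R : realType) (V : normedModType R) (T : Type) (s : seq T) (P : pred T)
    (h : T -> V -> R) (dh : T -> R) (z v : V) :
  (forall i, is_derive z v (h i) (dh i)) ->
  is_derive z v (fun u => \sum_(i <- s | P i) h i u) (\sum_(i <- s | P i) dh i).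
Proof.
move=> H; elim: s => [|i s IH].
  by under eq_fun do rewrite big_nil; rewrite big_nil; exact: is_derive_cst.
under eq_fun do rewrite big_cons; rewrite big_cons.
by case: (P i) => //; exact: is_deriveD.
Qed.

Lemma is_deriveMR (R : realType) (V : normedModType R) (f g : V -> R) (z v : V) (df dg : R) :
  is_derive z v f df -> is_derive z v g dg ->
  is_derive z v (fun u => f u * g u) (df * g z + f z * dg).
Proof.
move=> hf hg; have -> : df * g z + f z * dg = f z *: dg + g z *: df.
  by rewrite /GRing.scale /=; ring.
exact: is_deriveM.
Qed.

Lemma is_derive_bigprod (R : realType) (V : normedModType R) (T : eqType) (s : seq T)
    (h : T -> V -> R) (dh : T -> R) (z v : V) :
  uniq s -> (forall i, is_derive z v (h i) (dh i)) ->
  is_derive z v (fun u => \prod_(i <- s) h i u)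
    (\sum_(i <- s) dh i * \prod_(k <- s | k != i) h k z).
Proof.
move=> + H; elim: s => [_|i s IH].
  by under eq_fun do rewrite big_nil; rewrite big_nil; exact: is_derive_cst.
move=> /andP [si us]; under eq_fun do rewrite big_cons.
have := is_deriveMR (H i) (IH us); congr (is_derive _ _ _ _).
rewrite !big_cons eqxx /=; congr (_ * _ + _).
  rewrite [RHS]big_seq_cond [LHS]big_seq_cond; apply: eq_bigl => k.
  by rewrite andbT; have [ks /=|//] := boolP (k \in s); apply/esym; apply: contraNneq si => <-.
rewrite big_distrr /= big_seq_cond [RHS]big_seq_cond; apply: eq_bigr => k.
rewrite andbT => ks; rewrite big_cons ifT; first by rewrite mulrCA.
by apply: contraNneq si => ->.
Qed.

Section Forms.
Variables (R : realType) (n m : nat) (D : set 'rV[R]_n) (a : @components R n m).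
Hypothesis D_open : open D.
Hypothesis a_derivable : forall I x v, D x -> derivable (a I) x v.
Local Notation Z := ('rV[R]_n * 'rV[R]_n)%type.

Definition monomial (I : {ffun 'I_m -> 'I_n}) (y : 'rV[R]_n) : R := \prod_r y 0 (I r).

Definition monomial_partial (j : 'I_n) (I : {ffun 'I_m -> 'I_n}) (y : 'rV[R]_n) : R :=
  \sum_r (I r == j)%:R * \prod_(k | k != r) y 0 (I k).

Lemma is_derive_monomial j I (y : 'rV[R]_n) :
  is_derive y (basis_vec R j) (monomial I) (monomial_partial j I y).
Proof.
rewrite /monomial_partial; apply: is_derive_bigprod; first exact: index_enum_uniq.
move=> r; apply: is_derive_additive => h.
by rewrite !mxE eqxx.
Qed.

(** Here [q] is the monomial for first derivatives of the form, and its y-partial for the mixed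
    ones. *)
Lemma is_derive_form (q : {ffun 'I_m -> 'I_n} -> 'rV[R]_n -> R) (dq : {ffun 'I_m -> 'I_n} -> R)
   (z v : Z) : D z.1 -> (forall I, is_derive z.2 v.2 (q I) (dq I)) ->
  is_derive z v (fun w : Z => \sum_I a I w.1 * q I w.2)
    (\sum_I ('D_(v.1) (a I) z.1 * q I z.2 + a I z.1 * dq I)).
Proof.
move=> Dz dqz; apply: is_derive_bigsum => I; apply: is_deriveMR.
  by apply: (is_derive_fst (g := a I)); apply: derivableP; exact: a_derivable.
exact: (is_derive_snd (g := q I)).
Qed.

Lemma partial_x_mform k (z : Z) : D z.1 ->
  partial_x k (mform a) z = \sum_I partial k (a I) z.1 * monomial I z.2.
Proof.
move=> Dz; have H := is_derive_form (z := z) (v := (basis_vec R k, 0)) Dz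
  (fun I => is_derive0 (monomial I) z.2).
rewrite /partial_x (derive_val (is_derive := H)).
by apply: eq_bigr => I _; rewrite mulr0 addr0.
Qed.

Lemma partial_y_mform j (z : Z) : D z.1 ->
  partial_y j (mform a) z = \sum_I a I z.1 * monomial_partial j I z.2.
Proof.
move=> Dz; have H := is_derive_form (z := z) (v := (0, basis_vec R j)) Dz
  (fun I => is_derive_monomial j I z.2).
rewrite /partial_y (derive_val (is_derive := H)).
by apply: eq_bigr => I _; rewrite derive0 mul0r add0r.
Qed.

Lemma near_fst (z : Z) : D z.1 -> \near z, D z.1.
Proof.
move=> Dz; have : nbhs z.1 D by move: D_open; rewrite openE; apply.
exact: cvg_fst.
Qed.

Lemma partial_xy_mform k j (z : Z) : D z.1 ->
  partial_x k (partial_y j (mform a)) z =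
  \sum_I partial k (a I) z.1 * monomial_partial j I z.2.
Proof.
move=> Dz; have H := is_derive_form (z := z) (v := (basis_vec R k, 0)) Dz
  (fun I => is_derive0 (monomial_partial j I) z.2).
rewrite /partial_x (@near_eq_derive _ _ _ _ (fun w => \sum_I a I w.1 * monomial_partial j I w.2)).
  rewrite (derive_val (is_derive := H)).
  by apply: eq_bigr => I _; rewrite mulr0 addr0.
by near=> w; apply: partial_y_mform; near: w; exact: near_fst.
Unshelve. all: by end_near. Qed.

End Forms.

(** * Reindexing contractions of symmetric coefficients with powers of y *)

Section SymmetricForms.
Variables (R : comNzRingType) (n m : nat) (p0 : 'I_m).
Hypothesis p0E : p0 = 0%N :> nat.
Variable y : 'I_n -> R.
Implicit Types (I J : {ffun 'I_m -> 'I_n}) (b : {ffun 'I_m -> 'I_n} -> R).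

Lemma reindex_ffun_perm (s : 'S_m) (G : {ffun 'I_m -> 'I_n} -> R) :
  \sum_I G I = \sum_(I : {ffun 'I_m -> 'I_n}) G [ffun r => I (s r)].
Proof.
rewrite (reindex (fun I : {ffun 'I_m -> 'I_n} => [ffun r => I (s r)])) //.
exists (fun I : {ffun 'I_m -> 'I_n} => [ffun r => I ((s^-1)%g r)]) => I _;
  by apply/ffunP => r; rewrite !ffunE ?permK ?permKV.
Qed.

Lemma prod_perm (s : 'S_m) I : \prod_r y ([ffun r => I (s r)] r) = \prod_r y (I r).
Proof.
rewrite [RHS](reindex_inj (@perm_inj _ s)) /=.
by apply: eq_bigr => r _; rewrite ffunE.
Qed.

(** The transposition of p0 and r carries the term of position r to that of position p0, because b
    is symmetric; hence m equal terms. *)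
Lemma sym_partial_sum b j :
  (forall I (s : 'S_m), b [ffun r => I (s r)] = b I) ->
  \sum_(I : {ffun 'I_m -> 'I_n}) b I * (\sum_r (I r == j)%:R * \prod_(k | k != r) y (I k)) =
  m%:R * \sum_(I : {ffun 'I_m -> 'I_n} | I p0 == j) b I * \prod_(k | k != p0) y (I k).
Proof.
move=> bS.
transitivity (\sum_(r < m) \sum_(I : {ffun 'I_m -> 'I_n}) b I * ((I r == j)%:R * \prod_(k | k != r) y (I k))).
  by rewrite exchange_big; apply: eq_bigr => I _; rewrite big_distrr.
transitivity (\sum_(r < m) \sum_(I : {ffun 'I_m -> 'I_n} | I p0 == j) b I * \prod_(k | k != p0) y (I k)).
  apply: eq_bigr => r _; rewrite [RHS]big_mkcond (reindex_ffun_perm (tperm p0 r)) /=.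
  apply: eq_bigr => I _; rewrite bS ffunE tpermR.
  have -> : \prod_(k | k != r) y ([ffun r0 => I (tperm p0 r r0)] k) = \prod_(k | k != p0) y (I k).
    rewrite [RHS](reindex_inj (@perm_inj _ (tperm p0 r))) /=.
    apply: eq_big => [k|k _]; last by rewrite ffunE.
    by congr (~~ _); rewrite -[X in _ = (_ == X)](tpermR p0 r) (inj_eq perm_inj).
  by case: (_ == j); rewrite ?mul1r ?mul0r ?mulr0.
by rewrite sumr_const card_ord mulr_natl.
Qed.

Lemma set_first_first j I : set_first j I p0 = j.
Proof. by rewrite ffunE p0E. Qed.

Lemma set_first_rest j I r : r != p0 -> set_first j I r = I r.
Proof. by move=> rp; rewrite ffunE -p0E ifN. Qed.

Lemma set_first_twice i j I : set_first i (set_first j I) = set_first i I.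
Proof. by apply/ffunP => r; rewrite !ffunE; case: eqP. Qed.

Lemma set_first_id I : set_first (I p0) I = I.
Proof.
apply/ffunP => r; rewrite ffunE; case: eqP => // r0.
by congr (I _); apply: val_inj; rewrite /= p0E.
Qed.

(** The index k contracted with y moves into the first place, which was occupied by j: pairs of k
    and I with first entry j correspond to multi-indices J with first entry k, where I is
    [set_first j J]. *)
Lemma split_first_sum (c : 'I_n -> {ffun 'I_m -> 'I_n} -> R) j :
  \sum_k y k * (\sum_(I : {ffun 'I_m -> 'I_n} | I p0 == j) c k I * \prod_(r | r != p0) y (I r)) =
  \sum_(J : {ffun 'I_m -> 'I_n}) c (J p0) (set_first j J) * \prod_r y (J r).
Proof.
rewrite [RHS](partition_big (fun J => J p0) predT) //=; apply: eq_bigr => k _.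
rewrite (reindex_onto (set_first j) (set_first k)) /=; last first.
  by move=> I /eqP <-; rewrite set_first_twice set_first_id.
rewrite big_distrr /=; apply: eq_big => [J|J].
  rewrite set_first_first eqxx set_first_twice /=; apply/eqP/eqP => [<-|<-].
    by rewrite set_first_first.
  by rewrite set_first_id.
rewrite set_first_first eqxx set_first_twice /= => /eqP kJ.
have Jk : J p0 = k by rewrite -kJ set_first_first.
rewrite Jk mulrCA; congr (_ * _); rewrite [RHS](bigD1 p0) //= Jk; congr (_ * _).
by apply: eq_bigr => r rp; rewrite set_first_rest.
Qed.

Lemma iter_ordS_first (s : 'I_m) : iter s (@ordS m) p0 = s.
Proof.
apply: val_inj => /=; suff: forall k, (k < m)%N -> iter k (@ordS m) p0 = k :> nat by apply.
elim=> [_|k IH km]; first by rewrite p0E.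
by rewrite /= IH ?modn_small // ltnW.
Qed.

(** The cyclic shift by s is a permutation taking p0 to s and leaves the monomial unchanged, so
    after contraction with y all terms of the cyclic sum in [gamma] coincide. *)
Lemma cyc_sum (G : 'I_n -> {ffun 'I_m -> 'I_n} -> R) (s : 'I_m) :
  \sum_(J : {ffun 'I_m -> 'I_n}) G (J s) (cyc s J) * \prod_r y (J r) = \sum_(J : {ffun 'I_m -> 'I_n}) G (J p0) J * \prod_r y (J r).
Proof.
have tinj : injective (iter s (@ordS m)).
  by elim: (s : nat) => [|k IH] //= u v /(can_inj (@ordSK m)) /IH.
rewrite [RHS](reindex_ffun_perm (perm tinj)); apply: eq_bigr => J _.
rewrite prod_perm ffunE permE iter_ordS_first; congr (G _ _ * _).
by apply/ffunP => r; rewrite !ffunE permE.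
Qed.

End SymmetricForms.

(** * The symmetrized condition as Hamel's equations *)

Section Hamel.
Context {R : realType} {n : nat}.
Local Notation Z := ('rV[R]_n * 'rV[R]_n)%type.

Definition horizontal (L : Z -> R) (z : Z) : R := \sum_k z.2 0 k * partial_x k L z.

Definition horizontal_y (j : 'I_n) (L : Z -> R) (z : Z) : R :=
  \sum_k z.2 0 k * partial_x k (partial_y j L) z.

(* [A = F^m] turns Hamel's equations [y^k F_{x^k y^j} = F_{x^j}] into [hamel = 0]. *)
Definition hamel m (a : @components R n m) (j : 'I_n) (z : Z) : R :=
  m%:R * mform a z * (horizontal_y j (mform a) z - partial_x j (mform a) z)
  - (m%:R - 1) * partial_y j (mform a) z * horizontal (mform a) z.

Definition symm_defect m (hm : (2 <= m)%N) (a : @components R n m) (j : 'I_n) (x : 'rV[R]_n)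
    (I J : {ffun 'I_m -> 'I_n}) : R :=
  m%:R * (a I x * gamma a j J x) - a (set_first j I) x * partial (I (first_pos hm)) (a J) x.

Lemma sum_split_index (m : nat) (G : {ffun 'I_m -> 'I_n} -> {ffun 'I_m -> 'I_n} -> R) :
  \sum_(K : {ffun 'I_(m + m) -> 'I_n})
     G [ffun r => K (lshift m r)] [ffun r => K (rshift m r)] = \sum_I \sum_J G I J.
Proof.
rewrite pair_big /=.
pose join (p : {ffun 'I_m -> 'I_n} * {ffun 'I_m -> 'I_n}) : {ffun 'I_(m + m) -> 'I_n} :=
  [ffun r => match fintype.split r with inl i => p.1 i | inr i => p.2 i end].
rewrite (reindex join) /=.
  apply: eq_bigr => -[I J] _ /=.
  by congr (G _ _); apply/ffunP => r; rewrite /join !ffunE ?(unsplitK (inl r)) ?(unsplitK (inr r)).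
exists (fun K : {ffun 'I_(m + m) -> 'I_n} =>
    ([ffun r => K (lshift m r)] : {ffun 'I_m -> 'I_n},
     [ffun r => K (rshift m r)] : {ffun 'I_m -> 'I_n})) => [[I J]|K] _ /=.
  by congr (_, _); apply/ffunP => r; rewrite /join !ffunE ?(unsplitK (inl r)) ?(unsplitK (inr r)).
apply/ffunP => r; rewrite /join !ffunE; case: splitP => k rk; rewrite ffunE /=;
  by congr (K _); apply: val_inj.
Qed.

Lemma symm_sub (m : nat) (T1 T2 : {ffun 'I_m -> 'I_n} -> {ffun 'I_m -> 'I_n} -> R) I J :
  m%:R * symm T1 I J - symm T2 I J = symm (fun I J => m%:R * T1 I J - T2 I J) I J.
Proof. by rewrite /symm mulr_sumr -sumrB. Qed.

Section Form.
Variables (m : nat) (hm : (2 <= m)%N) (D : set 'rV[R]_n) (a : @components R n m).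
Hypothesis D_open : open D.
Hypothesis a_derivable : forall I x v, D x -> derivable (a I) x v.
Hypothesis a_sym : forall (I : {ffun 'I_m -> 'I_n}) (s : 'S_m) x, D x ->
  a [ffun r => I (s r)] x = a I x.
Local Notation p0 := (first_pos hm).

Lemma mR_neq0 : m%:R != 0 :> R.
Proof. by rewrite pnatr_eq0 -lt0n ltnW. Qed.

Lemma mR_sub1_neq0 : m%:R - 1 != 0 :> R.
Proof. by rewrite subr_eq0 (eqr_nat R m 1); case: m hm => [|[]]. Qed.

Lemma partial_components_sym k (I : {ffun 'I_m -> 'I_n}) (s : 'S_m) x : D x ->
  partial k (a [ffun r => I (s r)]) x = partial k (a I) x.
Proof.
move=> Dx; apply: near_eq_derive.
have : nbhs x D by move: D_open; rewrite openE; apply.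
by apply: filterS => u /a_sym ->.
Qed.

Lemma partial_y_mform_sym j x (y : 'rV[R]_n) : D x ->
  partial_y j (mform a) (x, y) =
  m%:R * \sum_(I : {ffun 'I_m -> 'I_n} | I p0 == j) a I x * \prod_(k | k != p0) y 0 (I k).
Proof.
move=> Dx; rewrite (partial_y_mform a_derivable) //=.
by apply: (@sym_partial_sum _ _ _ p0 (fun i => y 0 i)) => I s; exact: a_sym.
Qed.

Lemma horizontal_y_mform j x (y : 'rV[R]_n) : D x ->
  horizontal_y j (mform a) (x, y) =
  m%:R * \sum_(J : {ffun 'I_m -> 'I_n})
    partial (J p0) (a (set_first j J)) x * monomial J y.
Proof.
move=> Dx; rewrite -(split_first_sum (p0 := p0) _ (fun i => y 0 i) (fun k I => partial k (a I) x)) //.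
rewrite big_distrr /=; apply: eq_bigr => k _.
rewrite (partial_xy_mform D_open a_derivable) //=.
rewrite mulrCA; congr (_ * _).
by apply: (@sym_partial_sum _ _ _ p0 (fun i => y 0 i)) => I s; exact: partial_components_sym.
Qed.

(** After contraction the m cyclic terms are equal and together make up y^k A_{x^k y^j}; the
    subtracted term contracts to A_{x^j}. *)
Lemma gamma_sum j x (y : 'rV[R]_n) : D x ->
  \sum_(J : {ffun 'I_m -> 'I_n}) gamma a j J x * monomial J y =
  (m%:R * (m%:R - 1))^-1 *
    (horizontal_y j (mform a) (x, y) - partial_x j (mform a) (x, y)).
Proof.
move=> Dx; under eq_bigr do rewrite /gamma -mulrA.
rewrite -big_distrr /=; congr (_ * _).
under eq_bigr do rewrite mulrBl mulr_suml.
rewrite sumrB (partial_x_mform a_derivable) //=; congr (_ - _).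
rewrite exchange_big horizontal_y_mform //=.
under eq_bigr => s _ do
  rewrite (@cyc_sum _ _ _ p0 erefl (fun i => y 0 i) (fun k K => partial k (a (set_first j K)) x)).
by rewrite sumr_const card_ord mulr_natl.
Qed.

(** The index [I p0], freed by [set_first], is contracted with the derivative and gives y^k A_{x^k};
    the coefficients a with first index j give A_{y^j} / m. *)
Lemma set_first_sum j x (y : 'rV[R]_n) : D x ->
  \sum_(I : {ffun 'I_m -> 'I_n}) a (set_first j I) x *
      partial_x (I p0) (mform a) (x, y) * monomial I y =
  m%:R^-1 * (partial_y j (mform a) (x, y) * horizontal (mform a) (x, y)).
Proof.
move=> Dx.
rewrite -(split_first_sum (p0 := p0) _ (fun i => y 0 i)
  (fun k I => a I x * partial_x k (mform a) (x, y))) //.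
rewrite partial_y_mform_sym // -!mulrA (mulKf mR_neq0) /horizontal big_distrr /=.
apply: eq_bigr => k _; rewrite [RHS]mulrCA; congr (_ * _).
rewrite big_distrl /=; apply: eq_bigr => I _; ring.
Qed.

(** The factor comes from [gamma]; the second product carries 1 / m, which is (m - 1) times this
    factor, whence the coefficient m - 1 in [hamel]. *)
Lemma symm_defect_form j x (y : 'rV[R]_n) : D x ->
  \sum_(K : {ffun 'I_(m + m) -> 'I_n})
    symm_defect hm a j x [ffun r => K (lshift m r)] [ffun r => K (rshift m r)] *
      \prod_r y 0 (K r) = (m%:R * (m%:R - 1))^-1 * hamel a j (x, y).
Proof.
move=> Dx.
transitivity (\sum_(I : {ffun 'I_m -> 'I_n}) \sum_(J : {ffun 'I_m -> 'I_n})
   symm_defect hm a j x I J * (monomial I y * monomial J y)).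
  rewrite -sum_split_index; apply: eq_bigr => K _; congr (_ * _).
  by rewrite big_split_ord; congr (_ * _); apply: eq_bigr => r _; rewrite ffunE.
transitivity (m%:R * mform a (x, y) *
    (\sum_(J : {ffun 'I_m -> 'I_n}) gamma a j J x * monomial J y) -
  \sum_(I : {ffun 'I_m -> 'I_n}) a (set_first j I) x *
      partial_x (I p0) (mform a) (x, y) * monomial I y).
  have -> : mform a (x, y) = \sum_I a I x * monomial I y by [].
  rewrite mulr_sumr mulr_suml -sumrB; apply: eq_bigr => I _.
  rewrite (partial_x_mform a_derivable) //= !mulr_sumr mulr_suml -sumrB.
  by apply: eq_bigr => J _; rewrite /symm_defect /monomial; ring.
rewrite gamma_sum // set_first_sum // /hamel.
by field; rewrite mR_neq0 mR_sub1_neq0.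
Qed.

Lemma symm_defect_eq (j : 'I_n) x (I J : {ffun 'I_m -> 'I_n}) :
  (m%:R * symm (fun I J => a I x * gamma a j J x) I J =
    symm (fun I J => a (set_first j I) x * partial (I p0) (a J) x) I J) <->
  symm (symm_defect hm a j x) I J = 0.
Proof.
rewrite -symm_sub; split => [->|/eqP]; first by rewrite subrr.
by rewrite subr_eq0 => /eqP.
Qed.

(** The monomial in y is invariant under permutations of the 2m indices, so (2m)! times the
    contracted defect is the contraction of its symmetrization. *)
Lemma symm_hamel j x (y : 'rV[R]_n) : D x ->
  (forall I J, symm (symm_defect hm a j x) I J = 0) -> hamel a j (x, y) = 0.
Proof.
move=> Dx H; apply: (mulfI (x := (m%:R * (m%:R - 1))^-1)).
  by rewrite invr_eq0 mulf_neq0 // ?mR_neq0 ?mR_sub1_neq0.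
rewrite -symm_defect_form // mulr0.
pose T (K : {ffun 'I_(m + m) -> 'I_n}) :=
  symm_defect hm a j x [ffun r => K (lshift m r)] [ffun r => K (rshift m r)].
have E (s : 'S_(m + m)) : \sum_K T K * \prod_r y 0 (K r) =
    \sum_(K : {ffun 'I_(m + m) -> 'I_n}) T [ffun r => K (s r)] * \prod_r y 0 (K r).
  by rewrite (reindex_ffun_perm s); apply: eq_bigr => K _; rewrite (prod_perm (fun i => y 0 i)).
have : (\sum_K T K * \prod_r y 0 (K r)) *+ #|{: 'S_(m + m)}| = 0.
  rewrite -sumr_const (eq_bigr _ (fun s _ => E s)) exchange_big big1 //= => K _.
  rewrite -mulr_suml; apply/eqP; rewrite mulf_eq0; apply/orP; left; apply/eqP.
  rewrite -[RHS](H [ffun r => K (lshift m r)] [ffun r => K (rshift m r)]).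
  apply: eq_bigr => s _; rewrite /T.
  congr (symm_defect _ _ _ _ _ _); apply/ffunP => r; rewrite !ffunE;
    by case: splitP => k sk; rewrite ffunE; congr (K _); apply: val_inj.
move/eqP; rewrite mulrn_eq0 => /orP [|/eqP //].
by rewrite card_Sn eqn0Ngt fact_gt0.
Qed.

Lemma hamel_symm j x (y : 'rV[R]_n) (e : R) : D x -> 0 < e ->
  (forall y' : 'rV[R]_n, `|y' - y| < e -> hamel a j (x, y') = 0) ->
  forall I J, symm (symm_defect hm a j x) I J = 0.
Proof.
move=> Dx e0 H I J.
pose T (K : {ffun 'I_(m + m) -> 'I_n}) :=
  symm_defect hm a j x [ffun r => K (lshift m r)] [ffun r => K (rshift m r)].
have := @form_eq0_near_symm_eq0 R (m + m) n T y e e0 _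
  [ffun r => match fintype.split r with inl i => I i | inr i => J i end].
rewrite /T => <- => [|y' /H y'H]; last by rewrite symm_defect_form // y'H mulr0.
apply: eq_bigr => s _.
by congr (symm_defect _ _ _ _ _ _); apply/ffunP => r; rewrite !ffunE.
Qed.

End Form.
End Hamel.

(** * Homogeneous functions and the spray *)

Lemma mrootK (R : realType) (m : nat) (s : R) : (0 < m)%N -> has_mroot m s ->
  mroot m s ^+ m = s.
Proof.
move=> m0 ms; rewrite /mroot exprMn -(powR_mulrn m (powR_ge0 _ _)) -powRrM.
rewrite mulVf ?pnatr_eq0 -?lt0n // powRr1 // [RHS]numEsg.
have [->|s0] := eqVneq s 0; first by rewrite normr0 !mulr0.
congr (_ * _); case/orP: ms => [om|s1]; last first.
  by rewrite gtr0_sg ?expr1n // lt_def s0.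
have [s1|s1] := ltP 0 s; first by rewrite gtr0_sg ?expr1n.
by rewrite ltr0_sg ?lt_def 1?eq_sym ?s0 // -signr_odd om expr1 // lt_neqAle s0.
Qed.

Lemma mrootZ (R : realType) (m : nat) (c s : R) : (0 < m)%N -> 0 < c ->
  mroot m (c ^+ m * s) = c * mroot m s.
Proof.
move=> m0 c0; have cm : 0 < c ^+ m by rewrite exprn_gt0.
rewrite /mroot sgrM gtr0_sg // mul1r normrM powRM // gtr0_norm //.
rewrite -[c ^+ m]powR_mulrn ?ltW // -powRrM mulfV ?pnatr_eq0 -?lt0n // powRr1 ?ltW //.
by rewrite mulrCA.
Qed.

Lemma mformZ (R : realType) (n m : nat) (a : @components R n m) x (y : 'rV[R]_n) (c : R) :
  mform a (x, c *: y) = c ^+ m * mform a (x, y).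
Proof.
rewrite /mform /= big_distrr; apply: eq_bigr => I _ /=.
under eq_bigr do rewrite mxE.
by rewrite big_split /= prodr_const card_ord mulrCA.
Qed.

Lemma mroot_FZ (R : realType) (n m : nat) (a : @components R n m) x (y : 'rV[R]_n) (c : R) :
  (0 < m)%N -> 0 < c -> mroot_F a (x, c *: y) = c * mroot_F a (x, y).
Proof. by move=> m0 c0; rewrite /mroot_F mformZ mrootZ. Qed.

Lemma smooth_derive (R : realType) (V : normedModType R) (U : set V) (f : V -> R) (v : V) :
  smooth_on U f -> smooth_on U ('D_v f).
Proof. by move=> sf k; case: (sf k.+1) => _ /(_ v) []. Qed.

Lemma smooth_is_derive (R : realType) (V : normedModType R) (U : set V) (f : V -> R) (z v : V) :
  smooth_on U f -> U z -> is_derive z v f ('D_v f z).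
Proof. by move=> /(_ 1) sf Uz; apply/derivableP; exact: C1_derivable sf Uz. Qed.

Lemma open_near (R : realType) (V : normedModType R) (U : set V) (z : V) :
  open U -> U z -> \near z, U z.
Proof. by rewrite openE => oU Uz; exact: oU. Qed.

Lemma is_derive_exp (R : realType) (V : normedModType R) (f : V -> R) (k : nat) (z v : V) (df : R) :
  is_derive z v f df -> is_derive z v (fun u => f u ^+ k) (k%:R * f z ^+ k.-1 * df).
Proof. by move=> H; have := is_deriveX k H; rewrite exprfctE. Qed.

(** Applied with k = 2 to the metric and the spray, and with k = m to A = F^m. Where a predecessor
    is truncated, the coefficient in front vanishes. *)
Lemma derive_exp2 (R : realType) (V : normedModType R) (U : set V) (f : V -> R) (k : nat)
    (z u v : V) : open U -> U z -> smooth_on U f ->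
  'D_v ('D_u (fun w => f w ^+ k)) z =
  k%:R * (k.-1%:R * f z ^+ k.-2 * 'D_v f z * 'D_u f z + f z ^+ k.-1 * 'D_v ('D_u f) z).
Proof.
move=> oU Uz sf.
rewrite (@near_eq_derive _ _ _ _ (fun w => k%:R * (f w ^+ k.-1 * 'D_u f w))).
  have H := is_deriveMR (is_derive_exp k.-1 (smooth_is_derive v sf Uz))
    (smooth_is_derive v (smooth_derive u sf) Uz).
  have := is_deriveMR (is_derive_cst (k%:R : R) z v) H.
  by move=> /(@derive_val _ _ _ _ _ _ _) ->; rewrite mul0r add0r.
apply: filterS (open_near oU Uz) => w Uw.
by rewrite (derive_val (is_derive := is_derive_exp k (smooth_is_derive u sf Uw))) mulrA.
Qed.

Section Homogeneous.
Context {R : realType} {n : nat}.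
Local Notation Z := ('rV[R]_n * 'rV[R]_n)%type.

Definition phase_basis (i : 'I_n + 'I_n) : Z :=
  match i with inl k => (basis_vec R k, 0) | inr k => (0, basis_vec R k) end.

Definition phase_coord (z : Z) (i : 'I_n + 'I_n) : R :=
  match i with inl k => z.1 0 k | inr k => z.2 0 k end.

Lemma row_basis (y : 'rV[R]_n) : y = \sum_j y 0 j *: basis_vec R j.
Proof. exact: row_sum_delta. Qed.

Lemma sum_pair (T : Type) (s : seq T) (f g : T -> 'rV[R]_n) :
  \sum_(i <- s) ((f i, g i) : Z) = (\sum_(i <- s) f i, \sum_(i <- s) g i).
Proof.
elim: s => [|i s IH]; first by rewrite !big_nil.
by rewrite !big_cons IH.
Qed.

Lemma vertical_basis (y : 'rV[R]_n) : (0, y) = \sum_j y 0 j *: ((0, basis_vec R j) : Z).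
Proof.
have E j : y 0 j *: ((0, basis_vec R j) : Z) = (0, y 0 j *: basis_vec R j).
  by congr (_, _); rewrite scaler0.
under eq_bigr do rewrite E.
by rewrite sum_pair big1_eq -row_basis.
Qed.

Lemma horizontal_basis (x : 'rV[R]_n) : (x, 0) = \sum_j x 0 j *: ((basis_vec R j, 0) : Z).
Proof.
have E j : x 0 j *: ((basis_vec R j, 0) : Z) = (x 0 j *: basis_vec R j, 0).
  by congr (_, _); rewrite scaler0.
under eq_bigr do rewrite E.
by rewrite sum_pair big1_eq -row_basis.
Qed.

Lemma phase_coordK (z : Z) : z = \sum_i phase_coord z i *: phase_basis i.
Proof.
rewrite big_sumType /= -horizontal_basis -vertical_basis.
by case: z => x y; rewrite /= -[LHS]/((x, y) : Z); congr (_, _); rewrite ?addr0 ?add0r.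
Qed.

Lemma phase_coord_le (z : Z) i : `|phase_coord z i| <= `|z|.
Proof.
rewrite prod_normE; case: i => i /=; rewrite le_max; apply/orP; [left|right];
  exact: mx_norm_coord.
Qed.

Lemma smooth_lip_near (U : set Z) (f : Z -> R) z : open U -> U z -> smooth_on U f ->
  lip_near z f.
Proof.
move=> oU Uz /(_ 1) sf.
exact: (C1_lip_near phase_coordK phase_coord_le oU Uz sf).
Qed.

Lemma coord_lip_near (z : Z) i : lip_near z (fun w : Z => w.2 0 i).
Proof.
exists 1, 1; split => // u v _ _; rewrite mul1r.
by have := phase_coord_le (u - v) (inr i); rewrite /= !mxE.
Qed.

Section Calculus.
Variables (U : set Z) (F : Z -> R).
Hypothesis U_open : open U.
Hypothesis F_smooth : smooth_on U F.
Hypothesis F_hom : forall x y (c : R), 0 < c -> F (x, c *: y) = c * F (x, y).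

(** By linearity in the direction the sum is the derivative of F along (0, y). Its difference
    quotient is constantly F for |h| < 1, by homogeneity with the positive factor 1 + h. *)
Lemma euler z : U z -> \sum_j z.2 0 j * partial_y j F z = F z.
Proof.
move=> Uz; have := C1_derive_sum (index_enum 'I_n) (fun j => z.2 0 j)
  (fun j => (0, basis_vec R j) : Z) U_open Uz (F_smooth 1).
rewrite -vertical_basis => <-.
apply/cvg_lim => //; apply: cvg_near_cst; near=> h.
have h0 : h != 0 by near: h; exact: nbhs_dnbhs_neq.
have h1 : `|h| < 1 by near: h; apply: dnbhs0_lt.
have -> : (F \o shift z) (h *: (0, z.2)) = (1 + h) * F z.
  rewrite [in F z](surjective_pairing z) -F_hom; last first.
    by move: h1; rewrite ltr_norml; lra.
  rewrite /= scalerDl scale1r; congr F.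
  by rewrite [LHS]surjective_pairing /=; congr (_, _); rewrite ?scaler0 ?add0r // addrC.
by rewrite mulrDl mul1r addrC addKr /GRing.scale /= mulKf.
Unshelve. all: by end_near. Qed.

(** Euler's identity differentiated along v. For vertical v the second sum already equals the right
    side, so the first vanishes; for horizontal v the second sum is zero. *)
Lemma euler_derive z v : U z ->
  \sum_j z.2 0 j * 'D_v (partial_y j F) z + \sum_j v.2 0 j * partial_y j F z = 'D_v F z.
Proof.
move=> Uz.
rewrite -(@near_eq_derive _ _ _ (fun w : Z => \sum_j w.2 0 j * partial_y j F w) F z v); last first.
  by apply: filterS (open_near U_open Uz) => w; exact: euler.
rewrite -big_split /=.
have H : is_derive z v (fun w : Z => \sum_j w.2 0 j * partial_y j F w)
   (\sum_j (v.2 0 j * partial_y j F z + z.2 0 j * 'D_v (partial_y j F) z)).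
  apply: is_derive_bigsum => j; apply: is_deriveMR.
    by apply: is_derive_additive => h; rewrite /= !mxE.
  by apply: smooth_is_derive Uz; exact: smooth_derive.
rewrite (derive_val (is_derive := H)).
by apply: eq_bigr => j _; rewrite addrC.
Qed.

Lemma euler_yy i z : U z -> \sum_j z.2 0 j * partial_y i (partial_y j F) z = 0.
Proof.
move=> Uz; have := euler_derive (0, basis_vec R i) Uz.
rewrite [X in _ + X](bigD1 i) //= [X in _ + (_ + X)]big1 => [|j ji]; last first.
  by rewrite !mxE eqxx (negbTE ji) mul0r.
rewrite !mxE !eqxx mul1r addr0 => /eqP; rewrite -[eqbRHS]add0r => /eqP /addIr.
exact.
Qed.

Lemma euler_xy k z : U z ->
  \sum_j z.2 0 j * partial_x k (partial_y j F) z = partial_x k F z.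
Proof.
move=> Uz; have := euler_derive (basis_vec R k, 0) Uz.
by rewrite [X in _ + X]big1 ?addr0 // => j _; rewrite mxE mul0r.
Qed.

(** Contracting with y thus removes Hamel's expression from the spray, which is what determines the
    factor in [spray_hamel]. *)
Lemma horizontal_defect_orth z : U z ->
  \sum_j z.2 0 j * (horizontal_y j F z - partial_x j F z) = 0.
Proof.
move=> Uz; under eq_bigr do rewrite mulrBr.
rewrite sumrB; apply/eqP; rewrite subr_eq0; apply/eqP.
under eq_bigr do rewrite mulr_sumr.
rewrite exchange_big /=; apply: eq_bigr => k _.
rewrite -(euler_xy k Uz) mulr_sumr; apply: eq_bigr => j _.
by rewrite mulrCA.
Qed.

End Calculus.
End Homogeneous.

(** * Metric, spray and Hamel's expression in terms of F *)

Section RegularPoints.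
Context {R : realType} {n m : nat}.
Variables (hm : (2 <= m)%N) (D : set 'rV[R]_n) (a : @components R n m).
Local Notation Z := ('rV[R]_n * 'rV[R]_n)%type.
Local Notation F := (mroot_F a).

Let m0 : (0 < m)%N := ltnW hm.

(** Four times the spray with its index lowered by the metric. *)
Definition spray_covector (z : Z) (j : 'I_n) : R :=
  \sum_(k < n) partial_x k (partial_y j (fun w => F w ^+ 2)) z * z.2 0 k
  - partial_x j (fun w => F w ^+ 2) z.

Section Identities.
Variable U : set Z.
Hypothesis U_open : open U.
Hypothesis U_dom : forall w, U w -> D w.1 /\ has_mroot m (mform a w).
Hypothesis F_smooth : smooth_on U F.
Implicit Type z : Z.

Let F_hom x (y : 'rV[R]_n) (c : R) : 0 < c -> F (x, c *: y) = c * F (x, y).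
Proof. exact: mroot_FZ. Qed.

Lemma metric_tensor_mroot z i j : U z ->
  metric_tensor a z i j =
  partial_y i F z * partial_y j F z + F z * partial_y i (partial_y j F) z.
Proof.
move=> Uz; rewrite mxE [partial_y i (partial_y j _) z](derive_exp2 2 _ _ U_open Uz F_smooth).
rewrite /= expr0 expr1.
have alg (p q r s : R) : 2^-1 * (2 * (1 * 1 * p * q + s * r)) = p * q + s * r by field.
exact: alg.
Qed.

Lemma metric_tensor_euler z i : U z ->
  \sum_j metric_tensor a z i j * z.2 0 j = F z * partial_y i F z.
Proof.
move=> Uz.
transitivity (\sum_j (partial_y i F z * (z.2 0 j * partial_y j F z) +
   F z * (z.2 0 j * partial_y i (partial_y j F) z))).
  have alg (p q f r y : R) : (p * q + f * r) * y = p * (y * q) + f * (y * r) by ring.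
  by apply: eq_bigr => j _; rewrite (metric_tensor_mroot _ _ Uz) alg.
rewrite big_split /= -!mulr_sumr (euler U_open F_smooth F_hom Uz).
by rewrite (euler_yy U_open F_smooth F_hom i Uz) mulr0 addr0 mulrC.
Qed.

Lemma spray_covectorE z j : U z ->
  spray_covector z j = 2 * (horizontal F z * partial_y j F z +
    F z * (horizontal_y j F z - partial_x j F z)).
Proof.
move=> Uz; rewrite /spray_covector.
have -> : partial_x j (fun w => F w ^+ 2) z = 2 * (F z * partial_x j F z).
  have := is_derive_exp 2 (smooth_is_derive (basis_vec R j, 0) F_smooth Uz).
  by move=> /(@derive_val _ _ _ _ _ _ _); rewrite /= expr1 mulrA.
transitivity (\sum_k 2 * ((z.2 0 k * partial_x k F z) * partial_y j F z +
    F z * (z.2 0 k * partial_x k (partial_y j F) z)) - 2 * (F z * partial_x j F z)).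
  congr (_ - _); apply: eq_bigr => k _.
  rewrite [partial_x k (partial_y j _) z](derive_exp2 2 _ _ U_open Uz F_smooth) /= expr0 expr1.
  have alg (p q r s t : R) : 2 * (1 * 1 * p * q + s * r) * t = 2 * (t * p * q + s * (t * r)) by ring.
  exact: alg.
have alg (p q f h d : R) : 2 * (p * q + f * h) - 2 * (f * d) = 2 * (p * q + f * (h - d)) by ring.
by rewrite -mulr_sumr big_split /= -mulr_suml -mulr_sumr alg.
Qed.

(** Substituting A = F^m near z, the terms in F_{y^j} y^k F_{x^k} cancel: both carry m^2 (m - 1)
    F^(2m - 2). What remains is Hamel's expression for F, with a factor that is nonzero wherever F
    is. *)
Lemma hamel_mroot z j : U z ->
  hamel a j z = m%:R ^+ 2 * F z ^+ m * F z ^+ m.-1 * (horizontal_y j F z - partial_x j F z).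
Proof.
move=> Uz.
have FA w : U w -> F w ^+ m = mform a w by move=> /U_dom [_]; exact: mrootK.
have near_FA w : U w -> \near w, F w ^+ m = mform a w.
  by move=> Uw; apply: filterS (open_near U_open Uw) => u; exact: FA.
have D1 w v : U w -> 'D_v (mform a) w = m%:R * F w ^+ m.-1 * 'D_v F w.
  move=> Uw; rewrite -(near_eq_derive v (near_FA w Uw)).
  exact: (derive_val (is_derive := is_derive_exp m (smooth_is_derive v F_smooth Uw))).
have D2 u v : 'D_v ('D_u (mform a)) z = m%:R * (m.-1%:R * F z ^+ m.-2 * 'D_v F z * 'D_u F z +
    F z ^+ m.-1 * 'D_v ('D_u F) z).
  rewrite -(derive_exp2 m _ _ U_open Uz F_smooth); apply: near_eq_derive.
  apply: filterS (open_near U_open Uz) => w Uw; apply: near_eq_derive.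
  by apply: filterS (near_FA w Uw) => s ->.
have H0 : horizontal (mform a) z = m%:R * F z ^+ m.-1 * horizontal F z.
  rewrite /horizontal mulr_sumr; apply: eq_bigr => k _.
  by rewrite [partial_x k _ z]D1 // mulrCA.
have Hy : horizontal_y j (mform a) z = m%:R * (m.-1%:R * F z ^+ m.-2 * horizontal F z * partial_y j F z +
    F z ^+ m.-1 * horizontal_y j F z).
  have alg1 (c d y p q r f g : R) :
    y * (c * (d * f * p * q + g * r)) = c * (d * f * q * (y * p) + g * (y * r)) by ring.
  transitivity (\sum_k m%:R * (m.-1%:R * F z ^+ m.-2 * partial_y j F z *
      (z.2 0 k * partial_x k F z) + F z ^+ m.-1 * (z.2 0 k * partial_x k (partial_y j F) z))).
    by apply: eq_bigr => k _; rewrite [partial_x k (partial_y j (mform a)) z]D2 alg1.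
  by rewrite -mulr_sumr big_split -!mulr_sumr /= [in RHS]mulrAC.
rewrite /hamel H0 Hy [partial_x j _ z]D1 // [partial_y j (mform a) z]D1 // -FA //.
rewrite -/(partial_x j F z) -/(partial_y j F z).
have alg (c f g h p q y x : R) : g = h * f ->
    c * (g * f) * (c * ((c - 1) * h * p * q + g * y) - c * g * x) -
      (c - 1) * (c * g * q) * (c * g * p) = c ^+ 2 * (g * f) * g * (y - x).
  by move=> ->; ring.
have -> : F z ^+ m = F z ^+ m.-1 * F z by rewrite -exprSr prednK.
have -> : m.-1%:R = m%:R - 1 :> R by rewrite -[in RHS](prednK m0) -natr1 addrK.
(* The premise F^(m-1) = F^(m-2) F relies on m >= 2. *)
by apply: alg; rewrite -exprSr prednK // -ltnS prednK.
Qed.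

End Identities.
End RegularPoints.

(** * The spray at a regular point with nondegenerate metric *)

Section RegularMetric.
Context {R : realType} {n m : nat}.
Variables (hm : (2 <= m)%N) (D : set 'rV[R]_n) (a : @components R n m).
Local Notation Z := ('rV[R]_n * 'rV[R]_n)%type.
Local Notation F := (mroot_F a).
Implicit Type z : Z.

Let m0 : (0 < m)%N := ltnW hm.
Let F_hom x (y : 'rV[R]_n) (c : R) : 0 < c -> F (x, c *: y) = c * F (x, y).
Proof. exact: mroot_FZ. Qed.

Lemma regular_near z : regular D a z -> \near z, regular D a z.
Proof.
move=> [z0 [U [oU Uz UD sF]]]; near=> w; split; last first.
  by exists U; split => //; near: w; exact: (open_near oU Uz).
have zw : `|z - w| < `|z.2| by near: w; apply: (@near_dist_lt R Z); rewrite normr_gt0.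
apply: contraTneq zw => w0; rewrite -leNgt prod_normE le_max; apply/orP; right.
by rewrite /= w0 subr0.
Unshelve. all: by end_near. Qed.

Lemma metric_mul_direction z : regular D a z ->
  metric_tensor a z *m z.2^T = F z *: \col_i partial_y i F z.
Proof.
move=> [_ [U [oU Uz UD sF]]]; apply/colP => i; rewrite !mxE.
rewrite -(metric_tensor_euler hm oU sF i Uz).
by apply: eq_bigr => j _; rewrite [z.2^T _ _]mxE.
Qed.

Section Nondegenerate.
Variable z : Z.
Hypothesis rz : regular D a z.
Hypothesis dz : \det (metric_tensor a z) != 0.

Let g_unit : metric_tensor a z \in unitmx. Proof. by rewrite unitmxE unitfE. Qed.

Lemma mroot_F_neq0 : F z != 0.
Proof.
apply/negP => /eqP Fz; have := metric_mul_direction rz; rewrite Fz scale0r.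
move=> /(congr1 (mulmx (invmx (metric_tensor a z)))); rewrite mulKmx // mulmx0.
by move/eqP; rewrite trmx_eq0; apply/negP; case: rz.
Qed.

Lemma sprayE i : spray a z i =
  4^-1 * (invmx (metric_tensor a z) *m \col_j spray_covector a z j) i 0.
Proof. by rewrite mxE; congr (_ * _); apply: eq_bigr => j _; rewrite mxE. Qed.

(** Once Hamel's expression vanishes, the covector is 2 (y^k F_{x^k}) F_{y^j}, a multiple of F
    F_{y^j} = g_{jk} y^k; inverting g returns a multiple of y. *)
Lemma hamel_spray : (forall j, hamel a j z = 0) ->
  forall i, spray a z i = horizontal F z / (2 * F z) * z.2 0 i.
Proof.
move=> H i; rewrite sprayE; have := rz => -[_ [U [oU Uz UD sF]]].
have F0 := mroot_F_neq0.
have -> : \col_j spray_covector a z j =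
    (2 * horizontal F z / F z) *: (metric_tensor a z *m z.2^T).
  rewrite metric_mul_direction //; apply/colP => j; rewrite !mxE.
  rewrite (spray_covectorE oU sF j Uz).
  have := H j; rewrite (hamel_mroot hm oU UD sF j Uz) => /eqP.
  have c0 : m%:R ^+ 2 * F z ^+ m * F z ^+ m.-1 != 0.
    by rewrite !mulf_neq0 // ?expf_neq0 // pnatr_eq0 -lt0n.
  rewrite mulf_eq0 (negbTE c0) => /eqP ->.
  have alg (h f p : R) : f != 0 -> 2 * (h * p + f * 0) = 2 * h / f * (f * p) by move=> ?; field.
  exact: alg.
have alg (h f y : R) : f != 0 -> 4^-1 * (2 * h / f * y) = h / (2 * f) * y by move=> ?; field.
by rewrite -scalemxAr mulKmx // !mxE alg.
Qed.

(** Lowering the index turns the hypothesis into a covector equal to 4 mu F F_{y^j}. Contracting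
    with y gives y^k F_{x^k} = 2 mu F; put back, this leaves F times Hamel's expression equal to
    0. *)
Lemma spray_hamel (mu : R) : (forall i, spray a z i = mu * z.2 0 i) ->
  forall j, hamel a j z = 0.
Proof.
move=> H j; have := rz => -[_ [U [oU Uz UD sF]]].
have F0 := mroot_F_neq0.
have E k : spray_covector a z k = 4 * mu * (F z * partial_y k F z).
  have EE : \col_j spray_covector a z j = (4 * mu) *: (metric_tensor a z *m z.2^T).
    rewrite -[LHS](mulKVmx g_unit) scalemxAr; congr (_ *m _).
    apply/colP => i; rewrite [RHS]mxE [z.2^T _ _]mxE -mulrA -H sprayE.
    by rewrite mulrA mulfV ?mul1r // pnatr_eq0.
  have := congr1 (fun M : 'cV[R]_n => M k 0) EE.
  by rewrite metric_mul_direction // !mxE.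
have h0 : horizontal F z = 2 * mu * F z.
  have : \sum_k z.2 0 k * spray_covector a z k =
      \sum_k 4 * mu * F z * (z.2 0 k * partial_y k F z).
    have alg (c f p y : R) : y * (c * (f * p)) = c * f * (y * p) by ring.
    by apply: eq_bigr => k _; rewrite E alg.
  rewrite -mulr_sumr (euler oU sF F_hom Uz).
  under eq_bigr do rewrite (spray_covectorE oU sF _ Uz).
  have alg (y h p f d : R) : y * (2 * (h * p + f * d)) = 2 * h * (y * p) + 2 * f * (y * d).
    by ring.
  under eq_bigr do rewrite alg.
  rewrite big_split /= -!mulr_sumr (euler oU sF F_hom Uz).
  rewrite (horizontal_defect_orth oU sF F_hom Uz) mulr0 addr0.
  have alg2 (h f : R) : f != 0 -> 2 * h * f = 4 * mu * f * f -> h = 2 * mu * f.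
    by move=> f0 e; apply: (mulIf f0); lra.
  exact: alg2.
rewrite (hamel_mroot hm oU UD sF j Uz).
suff -> : horizontal_y j F z - partial_x j F z = 0 by rewrite mulr0.
have := E j; rewrite (spray_covectorE oU sF j Uz) h0.
have alg (f p d : R) : f != 0 -> 2 * (2 * mu * f * p + f * d) = 4 * mu * (f * p) -> d = 0.
  by move=> f0 e; apply: (mulfI f0); lra.
exact: alg.
Qed.

(** Near z the metric and the covector are polynomials in y, F and its first and second derivatives,
    all locally Lipschitz; the inverse metric follows by nondegeneracy. *)
Lemma spray_lip_near i : lip_near z (fun w : Z => spray a w i).
Proof.
have := rz => -[_ [U [oU Uz UD sF]]].
have lipD f : smooth_on U f -> lip_near z f by exact: smooth_lip_near.
have sx k := smooth_derive (basis_vec R k, 0 : 'rV[R]_n) sF.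
have sy k := smooth_derive (0 : 'rV[R]_n, basis_vec R k) sF.
have nU := open_near oU Uz.
apply: lip_nearM; first exact: lip_near_cst.
apply: lip_near_sum => j; apply: lip_nearM.
  apply: lip_near_invmx => // k l.
  apply: (@near_lip_near _ _ _ (fun w => partial_y k F w * partial_y l F w +
      F w * partial_y k (partial_y l F) w)).
    by apply: filterS nU => w Uw; rewrite (metric_tensor_mroot oU sF).
  apply: lip_nearD; apply: lip_nearM; apply: lipD => //; first exact: sy.
    exact: sy.
  exact: smooth_derive (sy l).
apply: (@near_lip_near _ _ _ (fun w => 2 * (horizontal F w * partial_y j F w +
    F w * (horizontal_y j F w - partial_x j F w)))).
  by apply: filterS nU => w Uw; rewrite -(spray_covectorE oU sF _ Uw).
apply: lip_nearM; first exact: lip_near_cst.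
apply: lip_nearD; apply: lip_nearM; try exact: lipD.
- apply: lip_near_sum => k; apply: lip_nearM; first exact: coord_lip_near.
  exact: lipD (sx k).
- exact: lipD (sy j).
apply: lip_nearD; last by apply: lip_nearN; exact: lipD (sx j).
apply: lip_near_sum => k; apply: lip_nearM; first exact: coord_lip_near.
by apply: lipD; exact: smooth_derive (sy j).
Qed.

End Nondegenerate.
End RegularMetric.

(** * Curves with acceleration parallel to the velocity *)

Lemma is_derive_cast (R : realType) (V : normedModType R) (f : V -> R) (z v : V) (l l' : R) :
  is_derive z v f l -> l = l' -> is_derive z v f l'.
Proof. by move=> H <-. Qed.

Lemma lip_near_comp (R : realType) (V W : normedModType R) (phi : V -> W) (h : W -> R) (z : V) :
  (forall u v, `|phi u - phi v| <= `|u - v|) -> lip_near (phi z) h ->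
  lip_near z (fun u => h (phi u)).
Proof.
move=> phi1 [L [r [L0 r0 H]]]; exists L, r; split => // u v ur vr.
apply: le_trans (H _ _ (le_lt_trans (phi1 _ _) ur) (le_lt_trans (phi1 _ _) vr)) _.
by rewrite ler_wpM2l.
Qed.

Section Curves.
Context {R : realType} {n : nat}.
Implicit Types (x : R -> 'rV[R]_n) (T : set R).

Lemma is_derive_rV x (l : 'rV[R]_n) (t : R) :
  (forall i, is_derive t 1 (fun s => x s 0 i) (l 0 i)) -> is_derive t 1 x l.
Proof.
move=> H; have dx : derivable x t 1.
  by apply/derivable_mxP => i j; rewrite ord1; case: (H j).
split => //; rewrite derive_mx //; apply/rowP => i; rewrite !mxE.
by case: (H i).
Qed.

Lemma is_derive_coord x (t : R) i : derivable x t 1 ->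
  is_derive t 1 (fun s => x s 0 i) (derive1 x t 0 i).
Proof.
move=> dx; split; first by move/derivable_mxP: (dx); apply.
by rewrite derive1E derive_mx // mxE.
Qed.

Lemma derive0_interval_cst (T : set R) (g : R -> R) (s t : R) : is_interval T ->
  (forall r, T r -> is_derive r 1 g 0) -> T s -> T t -> g s = g t.
Proof.
move=> iT dg; wlog st : s t / s <= t.
  move=> W Ts Tt; case: (leP s t) => [/W|/ltW /W]; first exact.
  by move=> /(_ Tt Ts) ->.
move=> Ts Tt; have inT (r : R) : r \in `[s, t] -> T r.
  by rewrite in_itv /= => /andP [sr rt]; apply: (iT s t) => //; rewrite sr.
have d1 (r : R) : r \in `]s, t[ -> is_derive r 1 g 0.
  by move=> ri; apply/dg/inT; exact: subset_itv_oo_cc.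
have c1 : {within `[s, t], continuous g}.
  by apply: derivable_within_continuous => r /inT /dg [].
have [c _ /eqP] := MVT_segment st d1 c1.
by rewrite mul0r subr_eq0 => /eqP.
Qed.

Lemma neq0_coord (v : 'rV[R]_n) : v != 0 -> exists k, v 0 k != 0.
Proof.
move=> v0; apply/existsP; rewrite -negb_forall; apply: contra v0 => /forallP H.
by apply/eqP/rowP => k; rewrite mxE; apply/eqP.
Qed.

(* The matrix [x'_i x'_k / |x'|^2] of the direction is constant, because [x''] is
   parallel to [x']; no regularity of the factor is needed. *)
Lemma parallel_acceleration_direction x T (la : R -> R) (s t : R) (i k : 'I_n) :
  is_interval T ->
  (forall r, T r -> [/\ derivable (derive1 x) r 1, derive1 x r != 0 &
    forall i, derive1 (derive1 x) r 0 i = la r * derive1 x r 0 i]) ->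
  T s -> T t ->
  derive1 x s 0 k != 0 ->
  derive1 x t 0 i * derive1 x s 0 k = derive1 x t 0 k * derive1 x s 0 i.
Proof.
move=> iT H Ts Tt.
pose q r := \sum_l derive1 x r 0 l * derive1 x r 0 l.
have q0 r : T r -> 0 < q r.
  move=> /H [_ /neq0_coord [l xl] _]; rewrite /q (bigD1 l) //= ltr_wpDr //.
    by apply: sumr_ge0 => j _; rewrite -expr2 sqr_ge0.
  by rewrite -expr2 exprn_even_gt0.
have dq r : T r -> is_derive r 1 q (2 * la r * q r).
  move=> /H [dx _ E]; rewrite /q mulr_sumr; apply: is_derive_bigsum => l.
  have := is_deriveMR (is_derive_coord l dx) (is_derive_coord l dx).
  by rewrite E => /is_derive_cast; apply; ring.
have C j l : derive1 x s 0 j * derive1 x s 0 l / q s = derive1 x t 0 j * derive1 x t 0 l / q t.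
  apply: (derive0_interval_cst (g := fun r => derive1 x r 0 j * derive1 x r 0 l / q r) iT) => // r Tr.
  have [dx _ E] := H r Tr.
  have qn : q r != 0 by rewrite gt_eqF ?q0.
  have dV : is_derive r 1 (fun r => (q r)^-1) (- (q r) ^- 2 *: (2 * la r * q r)).
    have [dq1 <-] := dq r Tr.
    by split; [exact: derivableV|exact: deriveV].
  have := is_deriveMR (is_deriveMR (is_derive_coord j dx) (is_derive_coord l dx)) dV.
  rewrite !E => /is_derive_cast; apply; rewrite /GRing.scale /=.
  have alg (a b c d : R) : d != 0 ->
    (c * a * b + a * (c * b)) * d^-1 + a * b * (- d ^- 2 * (2 * c * d)) = 0.
    by move=> ?; field.
  exact: alg.
have qs : q s != 0 by rewrite gt_eqF ?q0.
have qt : q t != 0 by rewrite gt_eqF ?q0.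
(* The entries (i, k) and (k, k) are enough: their quotient is x'_i / x'_k, and the second one shows
   that x'_k does not vanish at t. *)
move=> k0; have Cik := C i k; have Ckk := C k k.
have xt0 : derive1 x t 0 k != 0.
  apply: contraNneq k0 => xt0; move: Ckk; rewrite xt0 !mul0r => /eqP.
  by rewrite mulf_eq0 invr_eq0 (negbTE qs) orbF mulf_eq0 orbb.
have alg (a b c d e f : R) : e != 0 -> f != 0 -> b != 0 -> d != 0 ->
   a * b / e = c * d / f -> b * b / e = d * d / f -> c * b = d * a.
  move=> e0 f0 b0 d0 E1 E2.
  have E1' : a * b * f = c * d * e.
    by move/eqP: E1; rewrite eqr_div // => /eqP.
  have E2' : b * b * f = d * d * e.
    by move/eqP: E2; rewrite eqr_div // => /eqP.
  apply: (mulIf e0); apply: (mulIf d0).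
  have -> : c * b * e * d = b * (c * d * e) by ring.
  rewrite -E1'; have -> : d * a * e * d = a * (d * d * e) by ring.
  by rewrite -E2'; ring.
exact: alg Cik Ckk.
Qed.

(** Let v be the velocity at a fixed time s, with v_k nonzero. The direction being constant, x_i v_k
    - x_k v_i has derivative 0, so x t = x s + g t v. The parameter set is g(T), an interval as the
    continuous image of a connected set. *)
Lemma parallel_acceleration_straight x T (la : R -> R) :
  is_interval T -> T !=set0 ->
  (forall r, T r -> [/\ derivable x r 1, derivable (derive1 x) r 1, derive1 x r != 0 &
    forall i, derive1 (derive1 x) r 0 i = la r * derive1 x r 0 i]) ->
  straight (x @` T).
Proof.
move=> iT [s Ts] H.
have [dxs _ v0 _] := H s Ts.
pose v := derive1 x s; have [k vk] := neq0_coord v0.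
pose g t := (x t 0 k - x s 0 k) / v 0 k.
have xE t : T t -> x t = x s + g t *: v.
  move=> Tt; apply/rowP => i; rewrite !mxE.
  have : x t 0 i * v 0 k - x t 0 k * v 0 i = x s 0 i * v 0 k - x s 0 k * v 0 i.
    apply: (derive0_interval_cst (g := fun t => x t 0 i * v 0 k - x t 0 k * v 0 i) iT) => // r Tr.
    have [dx _ _ _] := H r Tr.
    have E : derive1 x r 0 i * derive1 x s 0 k = derive1 x r 0 k * derive1 x s 0 i.
      by apply: (parallel_acceleration_direction i iT _ Ts Tr vk) => u /H [].
    have := is_deriveB (is_deriveMR (is_derive_coord i dx) (is_derive_cst (v 0 k) r 1))
      (is_deriveMR (is_derive_coord k dx) (is_derive_cst (v 0 i) r 1)).
    by rewrite !mulr0 !addr0 => /is_derive_cast; apply; rewrite /v E subrr.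
  have alg (a b c d e f : R) : f != 0 -> a * f - b * c = d * f - e * c -> a = d + (b - e) / f * c.
    move=> f0 e1; apply: (mulIf f0); rewrite mulrDl.
    have -> : (b - e) / f * c * f = (b - e) * c by field.
    lra.
  exact: (alg _ _ _ _ _ _ vk).
exists (x s), v, (g @` T); split => //.
  apply/connected_intervalP; apply: connected_continuous_connected.
    exact/connected_intervalP.
  apply/continuous_in_subspaceT => t; rewrite inE => Tt.
  have [dx _ _ _] := H t Tt.
  have [+ _] := is_deriveMR (is_deriveB (is_derive_coord k dx) (is_derive_cst (x s 0 k) t 1))
    (is_derive_cst (v 0 k)^-1 t 1).
  by move=> /derivable1_diffP /differentiable_continuous.
apply/seteqP; split => [_ [t Tt <-]|_ [_ [t Tt <-] <-]] /=.
  by exists (g t); [exists t|rewrite -xE].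
by exists t; rewrite // -xE.
Qed.

(** Nothing is known about how the line's parameter depends on time, so it is eliminated through a
    coordinate k with v_k nonzero: x_i is an affine function of x_k. On the open set T this relation
    may be differentiated twice. *)
Lemma straight_parallel_acceleration x T (t : R) : open T -> T t ->
  (forall r, T r -> derivable x r 1 /\ derivable (derive1 x) r 1) ->
  derive1 x t != 0 -> straight (x @` T) ->
  exists mu, forall i, derive1 (derive1 x) t 0 i = mu * derive1 x t 0 i.
Proof.
move=> oT Tt H xt0 [p [v [J [v0 _ E]]]].
have [k vk] := neq0_coord v0.
pose c i := v 0 i / v 0 k.
have xE i r : T r -> p 0 i + (x r 0 k - p 0 k) * c i = x r 0 i.
  move=> Tr; have : (x @` T) (x r) by exists r.
  have alg (a b u w e : R) : e != 0 -> a + (b + u * e - b) * (w / e) = a + u * w.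
    by move=> ?; field.
  by rewrite E => -[u _ <-]; rewrite !mxE /c alg.
have nT r : T r -> \near r, T r by exact: open_near.
have d1 i r : T r -> derive1 x r 0 k * c i = derive1 x r 0 i.
  move=> Tr; have [dx _] := H r Tr.
  have [_ <-] := is_derive_coord i dx.
  rewrite -(@near_eq_derive _ _ _ (fun r => p 0 i + (x r 0 k - p 0 k) * c i)); last first.
    by apply: filterS (nT r Tr) => u; exact: xE.
  have := is_deriveD (is_derive_cst (p 0 i) r 1) (is_deriveMR
    (is_deriveB (is_derive_coord k dx) (is_derive_cst (p 0 k) r 1)) (is_derive_cst (c i) r 1)).
  by move=> [_ ->]; rewrite subr0 mulr0 addr0 add0r.
have d2 i : derive1 (derive1 x) t 0 k * c i = derive1 (derive1 x) t 0 i.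
  have [_ dx] := H t Tt.
  have [_ <-] := is_derive_coord i dx.
  rewrite -(@near_eq_derive _ _ _ (fun r => derive1 x r 0 k * c i)); last first.
    by apply: filterS (nT t Tt) => u; exact: d1.
  have := is_deriveMR (is_derive_coord k dx) (is_derive_cst (c i) t 1).
  by move=> [_ ->]; rewrite mulr0 addr0.
have xk : derive1 x t 0 k != 0.
  apply: contraNneq xt0 => xk; apply/eqP/rowP => i.
  by rewrite -d1 // xk mul0r mxE.
exists (derive1 (derive1 x) t 0 k / derive1 x t 0 k) => i.
by rewrite -(d1 i t Tt) -d2 mulrA divfK.
Qed.

End Curves.

(** * Geodesics *)

Section Geodesics.
Context {R : realType} {n m : nat}.
Variables (D : set 'rV[R]_n) (a : @components R n m).
Local Notation Z := ('rV[R]_n * 'rV[R]_n)%type.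

Hypothesis nondeg : forall z : Z, regular D a z -> \det (metric_tensor a z) != 0.

Definition split_phase (u : 'rV[R]_(n + n)) : Z := (lsubmx u, rsubmx u).

Lemma split_phase_lip (u v : 'rV[R]_(n + n)) : `|split_phase u - split_phase v| <= `|u - v|.
Proof.
rewrite prod_normE ge_max; apply/andP; split; apply: mx_norm_le => //= i; rewrite !mxE.
  by have := mx_norm_coord (u - v) (lshift n i); rewrite !mxE.
by have := mx_norm_coord (u - v) (rshift n i); rewrite !mxE.
Qed.

(** Picard's theorem for u = (x, y) with x' = y and y' = -2 G(x, y), written on row vectors of
    length n + n. Regular points form an open set, so the solution stays regular for a short
    time. *)
Lemma geodesic_through (z : Z) : regular D a z ->
  exists T (x : R -> 'rV[R]_n),
    [/\ geodesic D a T x, T 0, x 0 = z.1 & derive1 x 0 = z.2].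
Proof.
move=> rz.
pose f (u : 'rV[R]_(n + n)) : 'rV[R]_(n + n) :=
  row_mx (rsubmx u) (\row_i (- (2 * spray a (split_phase u) i))).
pose z0 : 'rV[R]_(n + n) := row_mx z.1 z.2.
have z0E : split_phase z0 = z.
  by rewrite /split_phase row_mxKl row_mxKr; case: (z).
have [|u [u0 [r r0 ur]]] := @picard_local R (n + n) f z0.
  move=> i; rewrite -(splitK i); case: (fintype.split i) => k /=.
    under eq_fun do rewrite row_mxEl mxE.
    exists 1, 1; split => // v w _ _; rewrite mul1r.
    by have := mx_norm_coord (v - w) (rshift n k); rewrite !mxE.
  under eq_fun do rewrite row_mxEr mxE.
  apply/lip_nearN/lip_nearM; first exact: lip_near_cst.
  apply: (lip_near_comp (h := fun w => spray a w k) split_phase_lip).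
  rewrite z0E; apply: (spray_lip_near rz); exact: nondeg.
have du (t : R) : `|t| < r -> is_derive t 1 u (f (u t)).
  by move=> tr; apply: is_derive_rV => i; exact: ur.
pose x t := lsubmx (u t); pose y t := rsubmx (u t).
have dx (t : R) : `|t| < r -> is_derive t 1 x (y t).
  move=> tr; apply: is_derive_rV => i.
  have -> : (fun s => x s 0 i) = (fun s => u s 0 (lshift n i)).
    by apply/funext => s; rewrite mxE.
  by have := ur t tr (lshift n i); rewrite row_mxEl.
have dy (t : R) : `|t| < r -> is_derive t 1 y (\row_i (- (2 * spray a (x t, y t) i))).
  move=> tr; apply: is_derive_rV => i.
  have -> : (fun s => y s 0 i) = (fun s => u s 0 (rshift n i)).
    by apply/funext => s; rewrite mxE.
  by have := ur t tr (rshift n i); rewrite row_mxEr.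
have x'E (t : R) : `|t| < r -> derive1 x t = y t.
  by move=> /dx [_ <-]; rewrite derive1E.
have [e e0 He] : exists2 e : R, 0 < e & forall t : R, `|t| < e -> regular D a (x t, y t).
  have /nbhs_normP [d d0 Hd] := regular_near rz.
  have uc : {for (0 : R), continuous u}.
    have [|+ _] := du 0; first by rewrite normr0.
    by move=> /derivable1_diffP /differentiable_continuous.
  move/cvgrPdist_lt : uc => /(_ d d0) /nbhs_normP [e e0 He].
  exists e => // t te; apply: Hd; rewrite /ball_ /= -z0E -u0.
  apply: le_lt_trans (split_phase_lip _ _) _; apply: He.
  by rewrite /ball_ /= sub0r normrN.
pose T : set R := [set t | `|t| < Num.min r e].
have Tr t : T t -> `|t| < r by rewrite /T /= lt_min => /andP [].
have Te t : T t -> `|t| < e by rewrite /T /= lt_min => /andP [].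
have T0 : T 0 by rewrite /T /= normr0 lt_min r0.
have oT : open T.
  have -> : T = ball (0 : R) (Num.min r e).
    by apply/seteqP; split => t; rewrite /T /ball /= sub0r normrN.
  exact: ball_open.
exists T, x; split => //; last by rewrite x'E ?normr0 // /y u0 row_mxKr.
  split => // [s t /= Ts Tt w /andP [sw wt]|t Tt].
    move: Ts Tt; rewrite /T /= !ltr_norml => /andP [s1 _] /andP [_ t2].
    by rewrite (lt_le_trans s1 sw) (le_lt_trans wt t2).
  have nx : \near t, y t = derive1 x t.
    by apply: filterS (open_near oT Tt) => w /Tr /x'E.
  have [d2 e2] := near_eq_is_derive nx (dy t (Tr t Tt)).
  have [dxt _] := dx t (Tr t Tt).
  split => //.
  - by have [_ [U [_ Uz UD _]]] := He t (Te t Tt); case: (UD _ Uz).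
  - by rewrite x'E ?Tr //; exact/He/Te.
  - by move=> i; rewrite (derive1E (derive1 x)) e2 mxE x'E ?Tr // addNr.
by rewrite /x u0 row_mxKl.
Qed.

End Geodesics.

Section HamelGeodesics.
Context {R : realType} {n m : nat}.
Variables (hm : (2 <= m)%N) (D : set 'rV[R]_n) (a : @components R n m).
Local Notation Z := ('rV[R]_n * 'rV[R]_n)%type.
Hypothesis nondeg : forall z : Z, regular D a z -> \det (metric_tensor a z) != 0.

Lemma hamel_geodesics_straight (y0 : 'rV[R]_n) : y0 != 0 ->
  (forall j (z : Z), regular D a z -> hamel a j z = 0) ->
  forall T x, geodesic D a T x -> straight (x @` T).
Proof.
move=> y00 H T x [oT iT G].
have [->|T0] := eqVneq T set0.
  (* The empty curve must also be [straight], which asks for some nonzero vector: this is the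
     purpose of y0. *)
  by exists 0, y0, set0; split => //; rewrite !image_set0.
pose z t : Z := (x t, derive1 x t).
(* The factor of x'' = -2 G = -2 P x', with P as in [hamel_spray]. *)
pose la t := - (2 * (horizontal (mroot_F a) (z t) / (2 * mroot_F a (z t)))).
apply: (parallel_acceleration_straight (la := la)) => //; first exact/set0P.
move=> t /G [Dx dx d2x rz E]; split => // [|i]; first by case: rz.
have := E i; rewrite (hamel_spray hm rz (nondeg rz)) => [|j]; last exact: H.
move/eqP; rewrite addr_eq0 => /eqP ->.
by rewrite /la mulNr mulrA.
Qed.

Lemma straight_geodesics_hamel :
  (forall T x, geodesic D a T x -> straight (x @` T)) ->
  forall j (z : Z), regular D a z -> hamel a j z = 0.
Proof.
move=> H j z rz.
have [T [x [G T0 x0 x'0]]] := geodesic_through nondeg rz.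
have := G => -[oT iT GT].
have [_ _ _ r0 E] := GT 0 T0.
have dT t : T t -> derivable x t 1 /\ derivable (derive1 x) t 1 by move=> /GT [].
have [mu muE] := straight_parallel_acceleration oT T0 dT r0.1 (H T x G).
rewrite x0 x'0 -surjective_pairing in E.
(* Comparing x'' = mu x' with x'' = -2 G gives G = -(mu / 2) y. *)
apply: (spray_hamel hm rz (nondeg rz) (mu := - (mu / 2))) => i.
have := E i; rewrite muE x'0.
have alg (c y s : R) : c * y + 2 * s = 0 -> s = - (c / 2) * y by lra.
exact: alg.
Qed.

End HamelGeodesics.

(** * The equivalence on the manifold, with the same chart on both sides *)

Theorem theorem18 (R : realType) (M : topologicalType) (n m : nat)
    (hm : (2 <= m)%N) (S : smooth_manifold R M n) (a : mroot_metric m S) :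
  projectively_flat a <->
  (forall p : M, exists c : chart R M n,
    [/\ atlas S c, chart_dom c p &
      forall x : 'rV[R]_n, chart_im c x ->
      forall (j : 'I_n) (I J : {ffun 'I_m -> 'I_n}),
        m%:R * symm (fun I J => comps a c I x * gamma (comps a c) j J x) I J
        = symm (fun I J => comps a c (set_first j I) x *
                           partial (I (first_pos hm)) (comps a c J) x) I J]).
Proof.
have D_open (c : chart R M n) : open (chart_im c) by exact: chart_im_open.
have a_derivable c I x v : atlas S c -> chart_im c x -> derivable (comps a c I) x v.
  by move=> Sc Dx; exact: C1_derivable (comps_smooth a I Sc 1) Dx.
have a_sym c (I : {ffun 'I_m -> 'I_n}) (s : 'S_m) x : atlas S c -> chart_im c x ->
    comps a c [ffun r => I (s r)] x = comps a c I x.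
  by move=> Sc Dx; exact: comps_sym.
have nondeg c : atlas S c -> forall z, regular (chart_im c) (comps a c) z ->
    \det (metric_tensor (comps a c) z) != 0.
  by move=> Sc z; exact: metric_nondeg.
split=> H p; have [c [Sc cp cH]] := H p; exists c; split => //.
  move=> x Dx j I J.
  apply/(symm_defect_eq hm (comps a c) j x I J).
  (* Over x there is a regular direction, and all directions close to it are regular: the open set
     on which the polarization rests. *)
  have [y ry] := metric_defined a Sc Dx.
  have /nbhs_normP [e e0 He] := regular_near ry.
  apply: (hamel_symm hm (D_open c) (fun I x v => a_derivable c I x v Sc)
    (fun I s x => a_sym c I s x Sc) (y := y) (e := e) Dx e0) => y' yy'.
  apply: (straight_geodesics_hamel hm (nondeg c Sc) cH); apply: He.
  by rewrite /ball_ /= prod_normE /= subrr normr0 gt_max e0 distrC yy'.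
have Dp : chart_im c (chart_map c p) by exists p.
(* A regular direction over p supplies the nonzero vector required for the empty geodesic. *)
have [y0 [y00 _]] := metric_defined a Sc Dp.
apply: (hamel_geodesics_straight hm (nondeg c Sc) y00) => j [x y] [_ [U [_ Uz UD _]]].
have [Dx _] := UD _ Uz.
apply: (symm_hamel (hm := hm) (D_open c) (fun I x v => a_derivable c I x v Sc)
    (fun I s x => a_sym c I s x Sc)) => // I J.
by apply/(symm_defect_eq hm (comps a c) j x I J); exact: cH.
Qed.
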